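(* Let $X$ be a sequential topological space. Then there exist a complete metric space $E$ whose metric is economical and a monotone quotient map $\xi: E\to X$ (in particular $X$ is the image of $E$ under $\xi$). If, in addition, $X$ is connected, then there exist such $E$ and $\xi$ with $E$ connected.
   Context: A topological space $X$ is sequential if for each non-closed subset $A\subset X$ there is a sequence of points of $A$ that converges to a point of $X\setminus A$. No separation axioms are assumed. The density of a space $A$ is $\mathrm{dens}(A)=\min\{|D|: D\subset A\subset \overline{D}\}$. The metric $d$ of a metric space $(E,d)$ is economical if for each infinite subset $A\subset E$ the set $d(A\times A)=\{d(a,b):a,b\in A\}$ has cardinality $|d(A\times A)|\le \mathrm{dens}(A)$. A surjective map $f:E\to X$ between topological spaces is monotone if $f^{-1}(x)$ is connected for every $x\in X$; it is quotient if a set $U\subset X$ is open in $X$ if and only if $f^{-1}(U)$ is open in $E$. *)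

(* Defs.v *)
From HB Require Import structures.
From mathcomp Require Import all_boot all_order all_algebra.
From mathcomp Require Import all_classical all_reals all_analysis.
Set Implicit Arguments.
Unset Strict Implicit.
Unset Printing Implicit Defensive.

Local Open Scope classical_set_scope.
Local Open Scope card_scope.
Local Open Scope ring_scope.

Definition sequential_space (X : topologicalType) : Prop :=
  forall A : set X, ~ closed A ->
    exists (u : nat -> X) (x : X),
      [/\ forall n, A (u n), ~ A x & u @ \oo --> x].

Definition dense_in (E : topologicalType) (A D : set E) : Prop :=
  D `<=` A /\ A `<=` closure D.

(* Cardinals are represented by sets: [is_dens A D] means that |D| = dens(A),
   i.e. D attains the minimum that defines dens(A).  Such a D always exists
   (cardinals are well-ordered) and is unique up to equipotence. *)
Definition is_dens (E : topologicalType) (A D : set E) : Prop :=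
  dense_in A D /\ forall D' : set E, dense_in A D' -> D #<= D'.

Definition economical (R : realType) (E : metricType R) : Prop :=
  forall A : set E, infinite_set A ->
    exists2 D : set E, is_dens A D
      & [set mdist p.1 p.2 | p in A `*` A] #<= D.

(* This is the axiom [cauchy_cvg] of [completeType]; the structure itself
   requires a point, which would exclude the empty metric space. *)
Definition complete_space (E : uniformType) : Prop :=
  forall F : set_system E, ProperFilter F -> cauchy F ->
    exists x : E, F --> x.

Definition monotone_map (E X : topologicalType) (f : E -> X) : Prop :=
  set_surj [set: E] [set: X] f /\
  forall x : X, connected (f @^-1` [set x]).

Definition quotient_map (E X : topologicalType) (f : E -> X) : Prop :=
  set_surj [set: E] [set: X] f /\
  forall U : set X, open U <-> open (f @^-1` U).

(* Main.v *)
(* Glue a copy of a connector C, a metric space with an origin and an end, along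
   each edge of a graph: the origin is the source of the edge and the end lies at
   distance [jump] from the target. C itself arises in this way from the graph
   with vertices in ]0, 1] and an edge of jump |s - t| from s to t, so that its
   points are finite or infinite sequences of edges (threads). A locally constant
   function on C that is constant on the copies of C is locally constant on the
   interval, hence constant; one that is not constant on C is therefore not
   constant on some copy, on some copy inside that copy, and so on, which
   contradicts local constancy at the infinite thread in the limit. So C is
   connected. All distances depend on finitely many digits of threads, and
   up to finitely many digits a limit of points of D is a truncation of a point
   of D, so a set with an infinite dense subset D has at most |D| distances.

   For a sequential space X, the vertices are the pairs (s, b) of a sequence and
   one of its limits, and there are edges of jump 1/(n+1), for all n, from (s, b)
   to (s', b') when s' n = b. The map sends the vertex (s, b), with the copies
   starting there, to b. In its fibers, the edges from (s, b) to the constant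
   sequence (b, b) show connectedness; the edges to (s', b') make the map
   quotient, because X is sequential. If X is connected then so is the
   source of the monotone quotient map. *)

Require Import Defs.
From HB Require Import structures.
From mathcomp Require Import all_boot all_order all_algebra.
From mathcomp Require Import all_classical all_reals all_analysis.
From mathcomp Require Import lra.

Set Implicit Arguments.
Unset Strict Implicit.
Unset Printing Implicit Defensive.

Import Order.TTheory GRing.Theory Num.Theory.
Import numFieldNormedType.Exports.

Local Open Scope classical_set_scope.

(** * Comparison of cardinals and squares of infinite sets *)

Section cardinals.
Local Open Scope card_scope.

Lemma card_le_inj (T U : Type) (A : set T) (B : set U) (f : T -> U) :
  (forall a, A a -> B (f a)) ->
  (forall a b, A a -> A b -> f a = f b -> a = b) -> A #<= B.
Proof.
move=> fAB finj; apply: inj_card_le; apply: unsquash.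
apply/injfunPex; exists f => //.
by move=> a b /set_mem Aa /set_mem Ab; exact: finj.
Qed.

Lemma card_le_ex_inj (T U : Type) (A : set T) (B : set U) (u0 : U) :
  A #<= B -> exists2 f : T -> U, (forall a, A a -> B (f a)) &
    (forall a b, A a -> A b -> f a = f b -> a = b).
Proof.
move=> /card_leP[f].
exists (fun a => if pselect (A a) is left Aa
                 then val (f (SigSub (mem_set Aa))) else u0).
  by move=> a Aa; case: pselect => // Aa'; exact/set_mem/valP.
move=> a b Aa Ab; case: pselect => // Aa'; case: pselect => // Ab'.
by move=> /val_inj/inj; rewrite !inE => /(_ I I) /(congr1 val).
Qed.

Lemma min_card (T : Type) (F : set (set T)) : F !=set0 ->
  exists2 D, F D & forall D', F D' -> D #<= D'.
Proof.
move=> [D0 FD0].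
have [[D [FD De]]|Fn0] := pselect (exists D, F D /\ ~ (D !=set0)).
  exists D => // D' _; rewrite (_ : D = set0) ?card_ge0//.
  by apply/eqP/negPn/negP => /set0P.
have {}Fn0 D : F D -> D !=set0.
  by move=> FD; apply: contrapT => De; apply: Fn0; exists D.
pose P (S : set (set T -> T)) :=
  (forall phi D, S phi -> F D -> D (phi D)) /\
  (forall phi psi D, S phi -> S psi -> F D -> phi D = psi D -> phi = psi).
have [|S [[SD Sinj] Smax]] := @Zorn_bigcup _ P.
  move=> C CP Ctot; split=> [phi D [S CS Sphi]|phi psi D [S CS Sphi] [S' CS'
    Spsi]].
    exact: (CP _ CS).1.
  have [SS'|S'S] := Ctot _ _ CS CS'.
    by apply: (CP _ CS').2 => //; exact: SS'.
  by apply: (CP _ CS).2 => //; exact: S'S.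
have [[D [FD DS]]|nD] := pselect (exists D, F D /\
    forall a, D a -> exists phi, S phi /\ phi D = a).
  exists D => // D' FD'.
  have /choice[h hP] a : exists phi, D a -> S phi /\ phi D = a.
    have [/DS[phi ?]|nDa] := pselect (D a); first by exists phi.
    by exists (fun=> a) => /nDa.
  apply: (@card_le_inj _ _ _ _ (fun a => h a D')) => [a Da|a b Da Db].
    exact: SD (hP _ Da).1 FD'.
  move=> /(Sinj _ _ _ (hP _ Da).1 (hP _ Db).1 FD') hab.
  by rewrite -(hP _ Da).2 -(hP _ Db).2 hab.
have [t0 _] := Fn0 _ FD0.
have /choice[phi0 phi0P] D : exists a, F D ->
    D a /\ forall phi, S phi -> phi D <> a.
  have [FD|nFD] := pselect (F D); last by exists t0 => /nFD.
  apply: contrapT => H; apply: nD; exists D; split=> // a Da.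
  apply: contrapT => H'; apply: H; exists a => _; split=> // phi Sphi phia.
  by apply: H'; exists phi.
exfalso; apply: (Smax (S `|` [set phi0])).
  split=> [phi Sphi|]; first by left.
  move=> /(_ phi0 (or_intror erefl)) Sphi0.
  by have [_ /(_ _ Sphi0)] := phi0P _ FD0.
split=> [phi D [Sphi|->] FD|phi psi D [Sphi|->] [Spsi|->] FD //].
- exact: SD Sphi FD.
- by have [] := phi0P _ FD.
- exact: Sinj Sphi Spsi FD.
- by have [_ /(_ _ Sphi)] := phi0P _ FD.
- by have [_ /(_ _ Spsi) H] := phi0P _ FD => /esym/H.
Qed.

Lemma card_le_total (T : Type) (A B : set T) : A #<= B \/ B #<= A.
Proof.
have [|D [->|->] DP] := @min_card T [set A; B]; first by exists A; left.
  by left; apply: DP; right.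
by right; apply: DP; left.
Qed.

(* Zorn's lemma is applied to the graphs of injections [B * B -> B] with
   [B `<=` D], all extending one on a countable set. *)
Lemma card_square (T : Type) (D : set T) : infinite_set D -> D `*` D #<= D.
Proof.
move=> Dinf; have [x0 Dx0] := infinite_setN0 Dinf.
have /(card_le_ex_inj x0)[i iD iinj] := (infiniteP D).1 Dinf.
have {}iD n : D (i n) by exact: iD.
have {}iinj m n : i m = i n -> m = n by exact: iinj.
have /(card_le_ex_inj 0%N)[h _ hinj] : [set: nat * nat] #<= [set: nat].
  by have := card_nat2; rewrite card_eq_le => /andP[].
have {}hinj p q : h p = h q -> p = q by exact: hinj.
pose fld (G : set ((T * T) * T)) := [set a | exists c, G ((a, a), c)].
pose good (G : set ((T * T) * T)) := [/\
  (forall a b c, G ((a, b), c) -> [/\ fld G a, fld G b, fld G c & D a]),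
  (forall a b, fld G a -> fld G b -> exists c, G ((a, b), c)),
  (forall p c c', G (p, c) -> G (p, c') -> c = c') &
  (forall p p' c, G (p, c) -> G (p', c) -> p = p')].
have fldS G G' : G `<=` G' -> fld G `<=` fld G'.
  by move=> GG' a [c ?]; exists c; exact: GG'.
pose G0 : set ((T * T) * T) :=
  [set q | exists m n, q = ((i m, i n), i (h (m, n)))].
have G0fld n : fld G0 (i n) by exists (i (h (n, n))); exists n, n.
have G0good : good G0.
  split.
  - by move=> a b c [m [n [-> -> ->]]]; split.
  - move=> a b [_ [m [_ [-> _ _]]]] [_ [n [_ [-> _ _]]]].
    by exists (i (h (m, n))), m, n.
  - move=> [a b] c c' [m [n [-> -> ->]]] [m' [n' [/iinj-> /iinj-> ->]]] //.
  - by move=> [a b] [a' b'] c [m [n [-> -> ->]]]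
      [m' [n' [-> -> /iinj/hinj[-> ->]]]].
(* [G0] is joined inside the predicate so that the union of the empty chain qualifies too. *)
have [|H [HG Hmax]] := @Zorn_bigcup _ [set H | good (H `|` G0)].
  move=> C CP Ctot.
  have [[H0 CH0]|Ce] := pselect (C !=set0); last first.
    rewrite /= (_ : \bigcup_(X in C) X = set0) ?set0U//.
    by apply/seteqP; split=> // q [X CX _]; apply: Ce; exists X.
  rewrite /=; set U := _ `|` G0.
  have UE q : U q -> exists2 X, C X & (X `|` G0) q.
    by move=> [[X CX Xq]|G0q]; [exists X => //; left|exists H0 => //; right].
  have UE2 q q' : U q -> U q' -> exists X, [/\ C X, (X `|` G0) q & (X `|` G0)
    q'].
    move=> /UE[X CX Xq] /UE[Y CY Yq']; have [XY|YX] := Ctot _ _ CX CY.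
      by exists Y; split => //; case: Xq => [/XY|]; [left|right].
    by exists X; split => //; case: Yq' => [/YX|]; [left|right].
  have XU X : C X -> X `|` G0 `<=` U.
    by move=> CX q [Xq|]; [left; exists X|right].
  split.
  - move=> a b c /UE[X CX Xabc]; have [X1 _ _ _] := CP _ CX.
    have [? ? ? ?] := X1 _ _ _ Xabc.
    by split => //; apply: fldS (XU _ CX) _ _.
  - move=> a b [c Uc] [c' Uc']; have [X [CX Xc Xc']] := UE2 _ _ Uc Uc'.
    have [_ X2 _ _] := CP _ CX.
    have [|d Xd] := X2 a b (ex_intro _ c Xc); first by exists c'.
    by exists d; exact: XU CX _ Xd.
  - move=> p c c' Uc Uc'; have [X [CX Xc Xc']] := UE2 _ _ Uc Uc'.
    by have [_ _ X3 _] := CP _ CX; exact: X3 Xc Xc'.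
  - move=> p p' c Uc Uc'; have [X [CX Xc Xc']] := UE2 _ _ Uc Uc'.
    by have [_ _ _ X4] := CP _ CX; exact: X4 Xc Xc'.
pose G := H `|` G0; pose B := fld G.
have {HG}[G1 G2 G3 G4] : good G by [].
have Bi n : B (i n) by apply: fldS (G0fld n) => q; right.
have BD a : B a -> D a by move=> [c /G1[]].
have /choice[f fG] p : exists c, B p.1 -> B p.2 -> G (p, c).
  have [[Bp1 Bp2]|nB] := pselect (B p.1 /\ B p.2); last first.
    by exists x0 => ? ?; exfalso; apply: nB.
  by have [c Gc] := G2 _ _ Bp1 Bp2; exists c; rewrite (surjective_pairing p).
have fB a b : B a -> B b -> B (f (a, b)).
  by move=> Ba Bb; have [] := G1 _ _ _ (fG (a, b) Ba Bb).
have finj a b a' b' : B a -> B b -> B a' -> B b' ->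
    f (a, b) = f (a', b') -> a = a' /\ b = b'.
  move=> Ba Bb Ba' Bb' fab; have := fG (a, b) Ba Bb; rewrite fab.
  by move=> /G4 /(_ (fG (a', b') Ba' Bb'))[].
(* In the first case [D] injects into [B], with tags [i 0] and [i 1], and [f] codes pairs. In the
   second, [j] puts a disjoint copy of [B] in [D], and [G] extends to the union of both, against
   maximality. *)
have [DB|BD'] : (D `\` B) #<= B \/ B #<= (D `\` B) by exact: card_le_total.
  have [k kB kinj] := card_le_ex_inj x0 DB.
  pose psi a := if `[< B a >] then f (a, i 0%N) else f (k a, i 1%N).
  have psiB a : D a -> B (psi a).
    by move=> Da; rewrite /psi; case: asboolP => Ba; apply: fB => //; exact: kB.
  have psiinj a b : D a -> D b -> psi a = psi b -> a = b.
    move=> Da Db; rewrite /psi; case: asboolP => Ba; case: asboolP => Bb.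
    - by move=> /(finj _ _ _ _ Ba (Bi _) Bb (Bi _))[].
    - by move=> /(finj _ _ _ _ Ba (Bi _) (kB _ (conj Db Bb)) (Bi _))[_ /iinj].
    - by move=> /(finj _ _ _ _ (kB _ (conj Da Ba)) (Bi _) Bb (Bi _))[_ /iinj].
    - move=> /(finj _ _ _ _ (kB _ (conj Da Ba)) (Bi _) (kB _ (conj Db Bb)) (Bi
        _)).
      by case=> /kinj + _; apply.
  apply: (@card_le_inj _ _ _ _ (fun p => f (psi p.1, psi p.2))).
    by move=> [a b] [/= Da Db]; apply/BD/fB; exact: psiB.
  move=> [a b] [a' b'] [/= Da Db] [/= Da' Db'].
  move=> /(finj _ _ _ _ (psiB _ Da) (psiB _ Db) (psiB _ Da') (psiB _ Db')).
  by move=> [/psiinj-> // /psiinj->].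
have [j jD jinj] := card_le_ex_inj x0 BD'.
pose e (x : T) (u : bool) := if u then j x else x.
have einj x y u v : B x -> B y -> e x u = e y v -> x = y /\ u = v.
  move=> Bx By; case: u; case: v => /= xy.
  - by rewrite (jinj _ _ Bx By xy).
  - by have [_] := jD x Bx; rewrite xy.
  - by have [_] := jD y By; rewrite -xy.
  - by rewrite xy.
pose t (u v : bool) : nat := u + v.*2.
have tinj u v u' v' : t u v = t u' v' -> u = u' /\ v = v'.
  by case: u; case: v; case: u'; case: v'.
(* The three new quarters of the enlarged square are sent into the copy [j] of [B]; the tag [t u v]
   keeps their images disjoint. *)
pose G' := G `|` [set q | exists x y u v, [/\ B x, B y, u || v &
  q = ((e x u, e y v), j (f (f (x, y), i (t u v))))]].
have G'B a : B a -> fld G' a by apply: fldS => q; left.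
have G'j a : B a -> fld G' (j a).
  move=> Ba; exists (j (f (f (a, a), i (t true true)))); right.
  by exists a, a, true, true.
have G'e a u : B a -> fld G' (e a u) by case: u; [exact: G'j|exact: G'B].
have G'fld a : fld G' a -> exists2 x, B x & exists u, a = e x u.
  move=> [c [Gc|[x [y [u [v [Bx By _ [-> _ _]]]]]]]].
    by exists a; [exists c|exists false].
  by exists x => //; exists u.
exfalso; apply: (Hmax G').
  split; first by move=> q Hq; left; left.
  move=> G'H; have : G ((j (i 0%N), j (i 0%N)),
      j (f (f (i 0%N, i 0%N), i (t true true)))).
    by left; apply: G'H; right; exists (i 0%N), (i 0%N), true, true.
  by move=> /G1[Bj _ _ _]; have [_] := jD _ (Bi 0%N); exact.
suff G'good : good G'.
  rewrite /= (_ : G' `|` G0 = G')//.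
  by apply/seteqP; split=> q; [case=> // G0q; left; right|left].
split.
- move=> a b c [/G1[Ba Bb Bc Da]|[x [y [u [v [Bx By _ [-> -> ->]]]]]]].
    by split=> //; exact: G'B.
  split; [exact: G'e|exact: G'e|apply/G'j/fB => //; exact: fB|].
  by case: u => /=; [have [] := jD _ Bx|exact: BD].
- move=> a b /G'fld[x Bx [u ->]] /G'fld[y By [v ->]].
  have [uv|] := boolP (u || v).
    by exists (j (f (f (x, y), i (t u v)))); right; exists x, y, u, v.
  rewrite negb_or => /andP[/negPf-> /negPf->] /=.
  by have [c Gc] := G2 _ _ Bx By; exists c; left.
- move=> [a b] c c' [Gc|[x [y [u [v [Bx By uv [-> -> ->]]]]]]]
      [Gc'|[x' [y' [u' [v' [Bx' By' uv' [ea eb ->]]]]]]].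
  + exact: G3 Gc Gc'.
  + have [Ba Bb _ _] := G1 _ _ _ Gc.
    have [_ uf] := einj _ _ false _ Ba Bx' ea.
    by have [_ vf] := einj _ _ false _ Bb By' eb; move: uv'; rewrite -uf -vf.
  + have [Ba Bb _ _] := G1 _ _ _ Gc'.
    have [_ uf] := einj x (e x u) u false Bx Ba erefl.
    have [_ vf] := einj y (e y v) v false By Bb erefl.
    by move: uv; rewrite uf vf.
  + have [-> ->] := einj _ _ _ _ Bx Bx' ea.
    by have [-> ->] := einj _ _ _ _ By By' eb.
- move=> p p' c [Gc|[x [y [u [v [Bx By uv [-> ->]]]]]]]
      [Gc'|[x' [y' [u' [v' [Bx' By' uv' [-> ec]]]]]]].
  + exact: G4 Gc Gc'.
  + move: p Gc => [a b] /G1[_ _ + _]; rewrite ec => Bj.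
    by have [_] := jD _ (fB _ _ (fB _ _ Bx' By') (Bi (t u' v'))); case.
  + move: p' Gc' => [a b] /G1[_ _ Bj _].
    by have [_] := jD _ (fB _ _ (fB _ _ Bx By) (Bi (t u v))); case.
  + move: ec => /jinj; move=> /(_ (fB _ _ (fB _ _ Bx By) (Bi _))).
    move=> /(_ (fB _ _ (fB _ _ Bx' By') (Bi _))).
    move=> /(finj _ _ _ _ (fB _ _ Bx By) (Bi _) (fB _ _ Bx' By') (Bi _)).
    by move=> [/(finj _ _ _ _ Bx By Bx' By')[-> ->] /iinj/tinj[-> ->]].
Qed.

End cardinals.

Local Open Scope ring_scope.

(** * Collapsed pseudometrics *)

Section collapse.
Context {R : realType}.

(* The pseudometric [m] on the classes of [k], where in each class the points of
   height [g x = 0] are collapsed to a single point, common to all classes. *)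
Definition collapse (T K : Type) (k : T -> K) (g : T -> R) (m : T -> T -> R)
    (x y : T) : R :=
  if `[< k x = k y >] then Num.min (m x y) (Num.max (g x) (g y))
  else Num.max (g x) (g y).

Variables (T K : Type) (k : T -> K) (g : T -> R) (m : T -> T -> R).
Hypothesis g_ge0 : forall x, 0 <= g x.
Hypothesis g_lip : forall x y, g x <= g y + m x y.
Hypothesis m_ge0 : forall x y, 0 <= m x y.
Hypothesis m_sym : forall x y, m x y = m y x.

Lemma collapse_ge0 x y : 0 <= collapse k g m x y.
Proof.
have := g_ge0 x; have := m_ge0 x y; rewrite /collapse.
by case: ifP => _ mxy gx; rewrite ?le_min ?le_max ?mxy gx.
Qed.

Lemma collapse_sym x y : collapse k g m x y = collapse k g m y x.
Proof.
rewrite /collapse m_sym [Num.max (g y) _]maxC.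
by rewrite (_ : `[< k y = k x >] = `[< k x = k y >])//; exact/asbool_equiv_eq.
Qed.

Lemma collapse_same x y : k x = k y ->
  collapse k g m x y = Num.min (m x y) (Num.max (g x) (g y)).
Proof. by move=> kxy; rewrite /collapse; case: asboolP. Qed.

Lemma collapse_diff x y : k x <> k y ->
  collapse k g m x y = Num.max (g x) (g y).
Proof. by move=> kxy; rewrite /collapse; case: asboolP. Qed.

Lemma collapse_lip x y : g x <= g y + collapse k g m x y.
Proof.
have := g_ge0 y; have := g_lip x y; have : g x <= Num.max (g x) (g y).
  by rewrite le_max lexx.
rewrite /collapse; move: (Num.max _ _) (m x y) => M c.
by case: ifP => _; [case: (leP c M) => _|]; lra.
Qed.

(** A change of class costs the maximum of the heights, and [collapse_lip] bounds the height left
    over. Inside one class, the cases are which term attains each minimum. *)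
Lemma collapse_tri y x z : (forall x y z, m x z <= m x y + m y z) ->
  collapse k g m x z <= collapse k g m x y + collapse k g m y z.
Proof.
move=> m_tri.
have maxl a b : a <= Num.max a b :> R by rewrite le_max lexx.
have maxr a b : b <= Num.max a b :> R by rewrite le_max lexx orbT.
have xyx := maxl (g x) (g y); have xyy := maxr (g x) (g y).
have yzy := maxl (g y) (g z); have yzz := maxr (g y) (g z).
have [kxz|kxz] := pselect (k x = k z).
  rewrite (collapse_same kxz).
  have [kxy|kxy] := pselect (k x = k y).
    rewrite (collapse_same kxy) collapse_same -?kxy//.
    have := g_ge0 y; have := g_lip x y; have := g_lip z y.
    have := m_ge0 x y; have := m_ge0 y z.
    rewrite (m_sym z y); have := m_tri x y z.
    move: xyx xyy yzy yzz; move: (Num.max _ (g y)) (Num.max (g y) _) => M N.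
    move: (m x y) (m y z) (m x z) => a b c; rewrite ge_min ge_max.
    case: (leP a M) => _; case: (leP b N) => _ *; apply/orP; [left|right..];
      by [lra|apply/andP; split; lra].
  have kyz : k y <> k z by rewrite -kxz => /esym.
  rewrite (collapse_diff kxy) (collapse_diff kyz) ge_min ge_max.
  have := g_ge0 y; move: xyx xyy yzy yzz.
  move: (Num.max _ (g y)) (Num.max (g y) _) => M N *.
  by apply/orP; right; apply/andP; split; lra.
rewrite (collapse_diff kxz) ge_max.
have [kxy|kxy] := pselect (k x = k y).
  have kyz : k y <> k z by rewrite -kxy.
  have := collapse_lip x y; have := collapse_ge0 x y.
  rewrite (collapse_diff kyz); move: (collapse k g m x y) => c *.
  by apply/andP; split; lra.
have [kyz|kyz] := pselect (k y = k z).
  have := collapse_lip z y; have := collapse_ge0 y z.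
  rewrite [collapse _ _ _ z y]collapse_sym (collapse_diff kxy).
  by move: (collapse k g m y z) => c *; apply/andP; split; lra.
have := g_ge0 y.
by rewrite (collapse_diff kxy) (collapse_diff kyz) => ?; apply/andP; split; lra.
Qed.

End collapse.

(** * Cauchy sequences for a distance function *)

Section sequences.
Context {R : realType}.
Variables (T : Type) (d : T -> T -> R).

Definition cauchy_for (x : nat -> T) := forall e, 0 < e ->
  exists N : nat, forall m n, (N <= m)%N -> (N <= n)%N -> d (x m) (x n) < e.

Definition cvg_for (x : nat -> T) (l : T) := forall e, 0 < e ->
  exists N : nat, forall n, (N <= n)%N -> d (x n) l < e.

Lemma cauchy_cluster_cvg (x : nat -> T) (l : T) :
  (forall y x z, d x z <= d x y + d y z) -> cauchy_for x ->
  (forall e N, 0 < e -> exists2 n, (N <= n)%N & d (x n) l < e) -> cvg_for x l.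
Proof.
move=> d_tri xC xl e e0; have e20 : 0 < e / 2 by rewrite divr_gt0.
have [N NC] := xC _ e20; exists N => n Nn.
have [m Nm ml] := xl _ N e20.
by have := NC _ _ Nn Nm; have := d_tri (x m) (x n) l; lra.
Qed.

End sequences.

(* An edge leads from [src] to [tgt], with a jump of size [jump] before [tgt];
   the edges [vert v], of jump 0, stand for the vertices. *)
Structure graph (R : realType) := Graph {
  edge : Type;
  vtx : Type;
  src : edge -> vtx;
  tgt : edge -> vtx;
  vert : vtx -> edge;
  jump : edge -> R;
  edist : edge -> edge -> R;
  src_vert : forall v, src (vert v) = v;
  tgt_vert : forall v, tgt (vert v) = v;
  jump_vert : forall v, jump (vert v) = 0;
  jump_ge0 : forall w, 0 <= jump w;
  edist_ge0 : forall v w, 0 <= edist v w;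
  edist_refl : forall w, edist w w = 0;
  edist_sym : forall v w, edist v w = edist w v;
  edist_tri : forall w v u, edist v u <= edist v w + edist w u;
  edist_src : forall w, edist w (vert (src w)) = 0;
  edist_tgt : forall w, edist w (vert (tgt w)) <= jump w
}.

(** Only a pseudometric, so that the truncated distances [sdist] are instances; nonnegativity
    follows from [tail_lip]. *)
Record tail_metric (R : realType) (Y : Type) (P : Y -> R) (d : Y -> Y -> R) :
    Prop := TailMetric {
  tail_refl : forall a, d a a = 0;
  tail_sym : forall a b, d a b = d b a;
  tail_tri : forall b a c, d a c <= d a b + d b c;
  tail_lip : forall a b, `|P a - P b| <= d a b
}.

(** * The metric on a graph with copies of a space glued along its edges *)

Section level.
Context {R : realType}.
Variables (G : graph R) (Y : Type) (P : Y -> R) (d : Y -> Y -> R).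
Local Notation W := (edge G).
Local Notation V := (vtx G).
Implicit Types x y z : W * Y.

(* [P a] is the position of [a] between the origin and the end of [Y]. The
   heights [outer] and [inner] measure how far [x] is from the vertices of the
   graph, resp. from the two ends of the copy of [Y] that contains [x]. *)
Definition node x : V := if P x.2 <= 2^-1 then src x.1 else tgt x.1.
Definition gap x : R := `|P x.2 - 2^-1|.
Definition outer x : R := 2^-1 * Num.min `|P x.2| (Num.max `|1 - P x.2| (jump
  x.1)).
Definition inner x : R := 2^-1 * Num.min `|P x.2| `|1 - P x.2|.

(** For [g] nonnegative, a hedgehog with one spine for each value of [k]; the distance between
    spines is the maximum of the heights rather than their sum. *)
Definition fan (K : Type) (k : W * Y -> K) (g : W * Y -> R) :=
  collapse k g (fun x y => `|g x - g y|).

(** The terms compare the edges, the nodes, the distances from the vertices, and the tails in a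
    common copy. [gap] vanishes at position 1/2, where [node] switches from source to target. The
    factor 1/2 before [d], matched by the one in [inner], makes nested copies shrink. *)
Definition level x y : R :=
  Num.max (Num.max (edist x.1 y.1) (fan node gap x y))
    (Num.max (fan fst outer x y)
       (collapse fst inner (fun x y => 2^-1 * d x.2 y.2) x y)).

Hypothesis dP : tail_metric P d.

Let d_refl := tail_refl dP.
Let d_sym := tail_sym dP.
Let d_tri := tail_tri dP.
Let P_lip := tail_lip dP.

Let d_ge0 a b : 0 <= d a b.
Proof. exact: le_trans (normr_ge0 _) (P_lip a b). Qed.

Lemma gap_ge0 x : 0 <= gap x. Proof. exact: normr_ge0. Qed.

Lemma outer_ge0 x : 0 <= outer x.
Proof. by rewrite mulr_ge0// le_min normr_ge0 le_max normr_ge0. Qed.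

Lemma inner_ge0 x : 0 <= inner x.
Proof. by rewrite mulr_ge0// le_min !normr_ge0. Qed.

Let min_lip (a b a' b' c : R) : a <= a' + c -> b <= b' + c ->
  Num.min a b <= Num.min a' b' + c.
Proof.
by move=> aa bb; rewrite ge_min; case: (leP a' b') => _; rewrite ?aa ?bb ?orbT.
Qed.

Let norm_lip (a b : R) : `|a| <= `|b| + `|a - b|.
Proof. by rewrite -[in leLHS](subrK b a) addrC ler_normD. Qed.

Lemma inner_lip x y : inner x <= inner y + 2^-1 * d x.2 y.2.
Proof.
rewrite -mulrDr ler_pM2l// min_lip//.
  by apply: le_trans (norm_lip _ (P y.2)) _; rewrite lerD2l.
apply: le_trans (norm_lip _ (1 - P y.2)) _; rewrite lerD2l.
by rewrite (_ : _ - _ = P y.2 - P x.2) 1?distrC ?P_lip//; lra.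
Qed.

Lemma outer_lip x y : x.1 = y.1 ->
  `|outer x - outer y| <= 2^-1 * `|P x.2 - P y.2|.
Proof.
move=> xy; suff H x' y' : x'.1 = y'.1 ->
    outer x' <= outer y' + 2^-1 * `|P x'.2 - P y'.2|.
  by have := H _ _ xy; have := H _ _ (esym xy); rewrite distrC ler_distl; lra.
move=> {}xy; rewrite -mulrDr ler_pM2l// min_lip//.
rewrite ge_max; apply/andP; split; last first.
  by rewrite xy -[leLHS]addr0 lerD// le_max lexx orbT.
apply: le_trans (norm_lip _ (1 - P y'.2)) _; rewrite lerD//.
  by rewrite le_max lexx.
by rewrite (_ : _ - _ = P y'.2 - P x'.2) 1?distrC//; lra.
Qed.

Let fan_lip (K : Type) (k : W * Y -> K) (g : W * Y -> R) x y :
  (forall x, 0 <= g x) -> g x <= g y + fan k g x y.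
Proof.
move=> g0; apply: collapse_lip => // {}x {}y.
by have := norm_lip (g x) (g y); rewrite !(ger0_norm (g0 _)).
Qed.

Let fan_sym (K : Type) (k : W * Y -> K) (g : W * Y -> R) x y : fan k g x y =
  fan k g y x.
Proof. by apply: collapse_sym => *; exact: distrC. Qed.

Let fan_tri (K : Type) (k : W * Y -> K) (g : W * Y -> R) y x z :
  (forall x, 0 <= g x) -> fan k g x z <= fan k g x y + fan k g y z.
Proof.
move=> g0; apply: collapse_tri => //.
- by move=> u v; have := norm_lip (g u) (g v); rewrite !(ger0_norm (g0 _)).
- by move=> *; exact: distrC.
- by move=> *; exact: ler_distD.
Qed.

Let dY x y : R := 2^-1 * d x.2 y.2.

Let dY_ge0 x y : 0 <= dY x y. Proof. by rewrite mulr_ge0. Qed.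

Let dY_sym x y : dY x y = dY y x. Proof. by rewrite /dY d_sym. Qed.

Let dY_tri x y z : dY x z <= dY x y + dY y z.
Proof. by rewrite /dY -mulrDr ler_pM2l. Qed.

Let levelE x y c : (level x y <= c) =
  [&& edist x.1 y.1 <= c, fan node gap x y <= c, fan fst outer x y <= c
    & collapse fst inner dY x y <= c].
Proof. by rewrite /level /dY !ge_max -andbA. Qed.

Let level_le x y : [/\ edist x.1 y.1 <= level x y, fan node gap x y <= level x
  y,
  fan fst outer x y <= level x y & collapse fst inner dY x y <= level x y].
Proof. by apply/and4P; rewrite -levelE. Qed.

Lemma level_ge0 x y : 0 <= level x y.
Proof. by have [+ _ _ _] := level_le x y; apply: le_trans;
  exact: edist_ge0. Qed.

Lemma level_sym x y : level x y = level y x.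
Proof.
rewrite /level edist_sym !(fan_sym _ _ x) (collapse_sym _ _ _ x y)//.
Qed.

Lemma level_tri y x z : level x z <= level x y + level y z.
Proof.
have [? ? ? ?] := level_le x y; have [? ? ? ?] := level_le y z.
rewrite levelE; apply/and4P; split.
- by apply: le_trans (edist_tri y.1 _ _) _; exact: lerD.
- by apply: le_trans (fan_tri _ y _ _ gap_ge0) _; exact: lerD.
- by apply: le_trans (fan_tri _ y _ _ outer_ge0) _; exact: lerD.
- apply: le_trans (collapse_tri _ inner_ge0 inner_lip dY_ge0 dY_sym y _ _
    dY_tri) _.
  exact: lerD.
Qed.

Lemma edge_le_level x y : edist x.1 y.1 <= level x y.
Proof. by have [] := level_le x y. Qed.

Lemma outer_le_level x y : x.1 <> y.1 -> outer x <= level x y.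
Proof.
move=> xy; have [_ _ + _] := level_le x y; rewrite /fan collapse_diff//.
by apply: le_trans; rewrite le_max lexx.
Qed.

Lemma gap_le_level x y : node x <> node y -> gap x <= level x y.
Proof.
move=> xy; have [_ + _ _] := level_le x y; rewrite /fan collapse_diff//.
by apply: le_trans; rewrite le_max lexx.
Qed.

Lemma outer_level_lip x y : outer x <= outer y + level x y.
Proof.
have [_ _ + _] := level_le x y; rewrite -(lerD2l (outer y)).
apply: le_trans; exact: fan_lip outer_ge0.
Qed.

Lemma inner_level_lip x y : inner x <= inner y + level x y.
Proof.
have [_ _ _ +] := level_le x y; rewrite -(lerD2l (inner y)); apply: le_trans.
exact: collapse_lip inner_ge0 inner_lip _ _.
Qed.

(** Below the height [inner x], the minimum in [collapse] can only be attained by the tail term. *)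
Lemma tail_le_level x y : x.1 = y.1 -> level x y < inner x ->
  d x.2 y.2 <= 2 * level x y.
Proof.
move=> xy; have [_ _ _] := level_le x y; rewrite collapse_same// ge_min ge_max.
by rewrite /dY => /orP[|/andP[? _]]; lra.
Qed.

Lemma level_same w a b : level (w, a) (w, b) <=
  Num.max `|P a - P b|
    (Num.min (2^-1 * d a b) (Num.max (inner (w, a)) (inner (w, b)))).
Proof.
set M := leRHS; have PM : `|P a - P b| <= M by rewrite le_max lexx.
rewrite levelE /= edist_refl /fan !(@collapse_same _ _ _ fst)//; apply/and4P;
  split.
- exact: le_trans PM.
- apply: le_trans PM; rewrite /collapse; case: asboolP => [_|].
    rewrite ge_min ; apply/orP; left; rewrite /gap/=.
    apply: le_trans (ler_dist_dist _ _) _.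
    by rewrite (_ : _ - _ = P a - P b)//; lra.
  (* The positions lie on either side of 1/2, so each gap is at most their difference. *)
  rewrite /node /gap /= ge_max.
  case: (leP (P a)) => Pa; case: (leP (P b)) => Pb // _.
    rewrite (distrC _ (P b)) (distrC _ 2^-1) !ger0_norm ?subr_ge0; lra.
  rewrite (distrC (P b) 2^-1) !ger0_norm ?subr_ge0; lra.
- rewrite ge_min; apply/orP; left; apply: le_trans (@outer_lip (w, a) (w, b)
    erefl) _ => /=.
  by apply: le_trans PM; have := normr_ge0 (P a - P b); lra.
- by rewrite le_max lexx orbT.
Qed.

Lemma level_same_le w a b : level (w, a) (w, b) <= d a b.
Proof.
apply: le_trans (level_same _ _ _) _; rewrite ge_max P_lip ge_min.
by apply/orP; left; have := d_ge0 a b; lra.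
Qed.

Lemma level_half w a b : P a = P b -> level (w, a) (w, b) <= 2^-1 * d a b.
Proof.
move=> ab; apply: le_trans (level_same _ _ _) _.
by rewrite ge_max ab subrr normr0 mulr_ge0//= ge_min lexx.
Qed.

Lemma level_refl x : level x x = 0.
Proof.
apply/eqP; rewrite eq_le level_ge0 andbT; case: x => w a.
by rewrite -(d_refl a) level_same_le.
Qed.

(** Near the end of a copy [inner] caps the tail term, however large [d a b] is. *)
Lemma level_near1 w a b : 0 < P a <= 1 -> P b = 1 ->
  level (w, a) (w, b) <= 1 - P a.
Proof.
move=> /andP[a0 a1] b1; apply: le_trans (level_same _ _ _) _.
rewrite ge_max b1 ler0_norm ?subr_le0// opprB lexx/= ge_min ge_max.
apply/orP; right; apply/andP; split; rewrite /inner/=.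
  rewrite (@ger0_norm _ (1 - P a)) ?subr_ge0// ler_pdivrMl//.
  by rewrite ge_min; apply/orP; right; lra.
rewrite b1 subrr normr0 min_r ?normr_ge0// mulr0; lra.
Qed.

Variable one : Y.
Hypothesis P_one : P one = 1.

Definition vertex v : W * Y := (vert v, one).

Lemma node_vertex v : node (vertex v) = v.
Proof. by rewrite /node /= P_one src_vert tgt_vert; case: ifP. Qed.

Lemma gap_vertex v : gap (vertex v) = 2^-1.
Proof. by rewrite /gap /= P_one ger0_norm; lra. Qed.

Lemma outer_vertex v : outer (vertex v) = 0.
Proof.
by rewrite /outer /= P_one jump_vert subrr normr0 maxxx normr1 min_r ?mulr0.
Qed.

Lemma inner_vertex v : inner (vertex v) = 0.
Proof. by rewrite /inner /= P_one subrr normr0 normr1 min_r ?mulr0. Qed.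

Lemma inner_le_outer x : inner x <= outer x.
Proof.
rewrite /inner /outer ler_pM2l// le_min; apply/andP; split.
  by rewrite ge_min lexx.
by rewrite ge_min; apply/orP; right; rewrite le_max lexx.
Qed.

(** The minimum in [outer] is attained by the position, near the source, or by the maximum, near the
    target of an edge of small jump. The bound 1/8 keeps these positions within 1/4 of the ends. *)
Lemma outer_cases x : 0 < P x.2 <= 1 -> outer x < 8^-1 ->
  (P x.2 <= 2^-1 /\ P x.2 = 2 * outer x) \/
  [/\ 2^-1 < P x.2, 1 - P x.2 <= 2 * outer x & jump x.1 <= 2 * outer x].
Proof.
move=> /andP[P0 P1]; rewrite /outer gtr0_norm// ger0_norm ?subr_ge0//.
have lM : 1 - P x.2 <= Num.max (1 - P x.2) (jump x.1) by rewrite le_max lexx.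
have rM : jump x.1 <= Num.max (1 - P x.2) (jump x.1) by rewrite le_max lexx
  orbT.
move: (Num.max _ _) lM rM => M lM rM.
by case: (leP (P x.2) M) => H ?; [left|right; split]; lra.
Qed.

(** With [outer_level_lip], this makes small values of [outer] comparable to the distance from the
    vertices. *)
Lemma level_node x : 0 < P x.2 <= 1 -> outer x < 8^-1 ->
  level x (vertex (node x)) <= 2 * outer x.
Proof.
move=> P01 x8; have O0 := outer_ge0 x; have /andP[P0 P1] := P01.
have lex : outer x <= 2 * outer x by lra.
rewrite levelE; apply/and4P; split.
- rewrite /node /=; case: (outer_cases P01 x8) => [[-> _]|[Px _ rx]].
    by rewrite edist_src; lra.
  by rewrite [_ <= 2^-1]leNgt Px/=; apply: le_trans (edist_tgt _) rx.
- rewrite /fan collapse_same ?node_vertex// gap_vertex ge_min; apply/orP; left.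
  rewrite /gap; case: (outer_cases P01 x8) => [[Px Pe]|[Px Pe _]].
    rewrite (@ler0_norm _ (P x.2 - 2^-1)) ?subr_le0//.
    by rewrite ler0_norm; lra.
  rewrite (@ger0_norm _ (P x.2 - 2^-1)) ?subr_ge0 ?(ltW Px)//.
  by rewrite ler0_norm; lra.
- rewrite /fan /collapse outer_vertex subr0 ger0_norm//.
  have M : Num.max (outer x) 0 <= 2 * outer x by rewrite ge_max lex mulr_ge0.
  by case: ifP => _ //; rewrite ge_min M orbT.
- rewrite /collapse inner_vertex; have I0 := inner_ge0 x.
  have IO := inner_le_outer x.
  have M : Num.max (inner x) 0 <= 2 * outer x.
    by rewrite ge_max; apply/andP; split; lra.
  by case: ifP => _ //; rewrite ge_min M orbT.
Qed.

Lemma level_start w a : 0 < P a < 4^-1 ->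
  level (w, a) (vertex (src w)) <= P a.
Proof.
move=> /andP[a0 a4]; have aO : 2 * outer (w, a) <= P a.
  by rewrite /outer mulrA divff// mul1r ge_min gtr0_norm ?lexx.
have : node (w, a) = src w by rewrite /node /= (_ : P a <= 2^-1)//; lra.
have := @level_node (w, a); move=> /[swap] -> H.
by apply: (le_trans _ aO); apply: H => /=; lra.
Qed.

Lemma level_end w : jump w < 4^-1 ->
  level (w, one) (vertex (tgt w)) <= jump w.
Proof.
move=> w4; have wO : 2 * outer (w, one) <= jump w.
  rewrite /outer mulrA divff// mul1r /= P_one subrr normr0 ge_min.
  by rewrite (max_r (jump_ge0 w)) lexx orbT.
have : node (w, one) = tgt w.
  rewrite /node /= P_one (_ : (1 <= 2^-1) = false)//.
  by apply/negbTE; rewrite -ltNge invf_lt1// ltr1n.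
have := @level_node (w, one); move=> /[swap] -> H.
by apply: (le_trans _ wO); apply: H; rewrite /= ?P_one; lra.
Qed.

Lemma level_le1 x y : edist x.1 y.1 <= 1 -> 0 < P x.2 <= 1 -> 0 < P y.2 <= 1 ->
  level x y <= 1.
Proof.
move=> dl1 x01 y01.
have col (K : Type) (k : W * Y -> K) g m : g x <= 1 -> g y <= 1 ->
    collapse k g m x y <= 1 :> R.
  move=> gx gy; rewrite /collapse; case: ifP => _; last by rewrite ge_max gx.
  by rewrite ge_min ge_max gx gy orbT.
have gap1 z : 0 < P z.2 <= 1 -> gap z <= 1.
  by move=> /andP[? ?]; rewrite /gap ler_norml; apply/andP; split; lra.
have outer1 z : 0 < P z.2 <= 1 -> outer z <= 1.
  move=> /andP[z0 z1]; rewrite /outer gtr0_norm//.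
  apply: (@le_trans _ _ (2^-1 * P z.2)); last by lra.
  by rewrite ler_pM2l// ge_min lexx.
have inner1 z (z01 : 0 < P z.2 <= 1) : inner z <= 1.
  exact: le_trans (inner_le_outer z) (outer1 z z01).
by rewrite levelE dl1 !col ?gap1 ?outer1 ?inner1.
Qed.

(** One representative for each point: origins are represented by source vertices, an edge of jump 0
    carries only its vertex, and [one] is the only end. *)
Definition proper x := [/\ 0 < P x.2 <= 1,
  jump x.1 = 0 -> x = vertex (src x.1) & P x.2 = 1 -> x.2 = one].

Lemma proper_outer x : proper x -> outer x <= 0 -> x = vertex (src x.1).
Proof.
move=> [/andP[P0 P1] xv _] O0; apply: xv; apply/eqP.
rewrite eq_le jump_ge0 andbT; move: O0; rewrite /outer pmulr_rle0//.
by rewrite ge_min normr_le0 gt_eqF//= ge_max => /andP[].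
Qed.

Lemma proper_inner x : proper x -> inner x <= 0 -> x.2 = one.
Proof.
move=> [/andP[P0 P1] _ x1]; rewrite /inner pmulr_rle0// ge_min !normr_le0.
by rewrite gt_eqF//= subr_eq0 => /eqP /esym.
Qed.

(** Points on distinct edges at distance 0 have [outer] zero, so they are vertices, and [gap] is 1/2
    there. *)
Lemma level_eq0 x y : proper x -> proper y -> level x y = 0 ->
  x.1 = y.1 /\ (d x.2 y.2 = 0 \/ x.2 = y.2).
Proof.
move=> px py xy0; have [xy|xy] := pselect (x.1 = y.1); last first.
  have xv : x = vertex (src x.1).
    by apply: proper_outer => //; rewrite -xy0; exact: outer_le_level.
  have yv : y = vertex (src y.1).
    apply: proper_outer => //; rewrite -xy0 level_sym.
    by apply: outer_le_level => /esym.
  have : gap x <= 0.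
    rewrite -xy0; apply: gap_le_level; rewrite xv yv !node_vertex => sxy.
    by apply: xy; rewrite xv yv /= sxy.
  by rewrite xv gap_vertex leNgt invr_gt0 ltr0n.
split=> //; have [ix|ix] := ltP 0 (inner x).
  left; have := tail_le_level xy; rewrite xy0 mulr0 => /(_ ix) d0.
  by apply/eqP; rewrite eq_le d0 d_ge0.
right; rewrite (proper_inner px ix) (proper_inner py)//.
by have := inner_level_lip y x; rewrite level_sym xy0; lra.
Qed.

Lemma level_vertex_near v y : level (vertex v) y < 2^-1 -> node y = v.
Proof.
move=> vy; apply: contrapT => yv; have := @gap_le_level (vertex v) y.
by rewrite node_vertex gap_vertex => /(_ (fun e => yv (esym e))); lra.
Qed.

Lemma level_edge_near x y : level x y < outer x -> x.1 = y.1.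
Proof.
by move=> xy; apply: contrapT => /outer_le_level; rewrite leNgt xy.
Qed.

(** The three outcomes correspond to [outer x] being zero, only [inner x] being zero, and
    neither. *)
Lemma level_near x (e : R) : proper x -> 0 < e -> exists2 c : R, 0 < c &
  forall y, level x y < c -> x = vertex (node y) \/
    (x.1 = y.1 /\ (x.2 = one \/ d x.2 y.2 < e)).
Proof.
move=> px e0; have [Ox|Ox] := ltP 0 (outer x); last first.
  exists 2^-1 => // y; rewrite (proper_outer px Ox) => /level_vertex_near ->.
  by left.
have [Ix|Ix] := ltP 0 (inner x); last first.
  exists (outer x) => // y /level_edge_near xy.
  by right; split=> //; left; exact: proper_inner.
exists (Num.min (outer x) (Num.min (inner x) (e / 2))).
  by rewrite !lt_min Ox Ix/=; lra.
move=> y; rewrite !lt_min => /and3P[xO xI xe].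
have xy := level_edge_near xO; right; split=> //; right.
by have := tail_le_level xy xI; lra.
Qed.

(** If [outer] is not eventually bounded below, the sequence clusters at a vertex. Otherwise the
    edge is eventually constant, and the same alternative for [inner] gives either the end of this
    edge or Cauchy tails. *)
Lemma level_cauchy (x : nat -> W * Y) : (forall n, proper (x n)) ->
  cauchy_for level x ->
  [\/ exists n, cvg_for level x (vertex (node (x n))),
      exists n, x n <> vertex (src (x n).1) /\ cvg_for level x ((x n).1, one) |
      exists n, [/\ x n <> vertex (src (x n).1),
        (exists N : nat, forall m, (N <= m)%N -> (x m).1 = (x n).1) &
        cauchy_for d (fun n => (x n).2)]].
Proof.
move=> px xC.
have [[c [M [c0 cO]]]|nO] := pselect (exists c (M : nat), 0 < c /\
    forall n, (M <= n)%N -> c <= outer (x n)); last first.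
  have small e (N : nat) : 0 < e -> exists2 n, (N <= n)%N & outer (x n) < e.
    move=> e0; apply: contrapT => H; apply: nO; exists e, N; split=> // n Nn.
    by rewrite leNgt; apply/negP => ne; apply: H; exists n.
  constructor 1; have [N NC] := xC 8^-1 ltac:(lra).
  have [n Nn n16] := small 8^-1 N ltac:(lra).
  exists n; apply: cauchy_cluster_cvg => // [|e K e0]; first exact: level_tri.
  have [m] := small (Num.min (e / 2) 8^-1) (maxn N K) ltac:(rewrite lt_min;
    lra).
  rewrite geq_max lt_min => /andP[Nm Km] /andP[me m8]; exists m => //.
  have [pm _ _] := px m.
  (* Where [outer] is below 1/8 the gap exceeds 1/4, so terms within 1/8 of each other share their
     node. *)
  have -> : node (x n) = node (x m).
    apply: contrapT => /gap_le_level; have := NC _ _ Nn Nm.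
    have [pn _ _] := px n; rewrite /gap; have /andP[P0 P1] := pn.
    case: (outer_cases pn n16) => [[Pn Pe]|[Pn Pe _]].
      by rewrite ler0_norm; lra.
    by rewrite ger0_norm; lra.
  by have := level_node pm m8; lra.
have [N NC] := xC _ c0.
pose n := maxn M N; have [Mn Nn] : (M <= n)%N /\ (N <= n)%N.
  by rewrite leq_maxl leq_maxr.
have xv : x n <> vertex (src (x n).1).
  by move=> xv; have := cO _ Mn; rewrite xv outer_vertex; lra.
have xe m : (N <= m)%N -> (x m).1 = (x n).1.
  move=> Nm; apply/esym/level_edge_near.
  by apply: lt_le_trans (NC _ _ Nn Nm) _; exact: cO.
have [[b [K [b0 bI]]]|nI] := pselect (exists b (K : nat), 0 < b /\
    forall n, (K <= n)%N -> b <= inner (x n)); last first.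
  constructor 2; exists n; split=> //.
  apply: cauchy_cluster_cvg => // [|e K e0]; first exact: level_tri.
  (* As [outer] is at least [c], the position is at least [2 * c]; so [inner] below [c / 2] means
     nearness to the end, not to the origin. *)
  have [m] : exists2 m, (maxn (maxn M N) K <= m)%N &
      inner (x m) < Num.min (c / 2) (e / 4).
    apply: contrapT => H; apply: nI.
    exists (Num.min (c / 2) (e / 4)), (maxn (maxn M N) K).
    split=> [|m Km]; first by rewrite lt_min; lra.
    by rewrite leNgt; apply/negP => me; apply: H; exists m.
  rewrite !geq_max lt_min => /andP[/andP[Mm Nm] Km] /andP[mc me];
    exists m => //.
  rewrite -(xe _ Nm) (surjective_pairing (x m)).
  have [pm _ _] := px m; have /andP[P0 P1] := pm.
  apply: le_lt_trans (level_near1 _ pm P_one) _.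
  move: mc me (cO _ Mm); rewrite /inner /outer !(gtr0_norm P0) ger0_norm
    ?subr_ge0//.
  have : Num.min (P (x m).2) (Num.max (1 - P (x m).2) (jump (x m).1)) <= P (x
    m).2.
    by rewrite ge_min lexx.
  move: (Num.min _ (Num.max _ _)) => h.
  by case: (leP (P (x m).2) (1 - _)) => H; lra.
constructor 3; exists n; split=> //; first by exists N.
move=> e e0; have [L LC] := xC (Num.min b (e / 2)) ltac:(rewrite lt_min; lra).
exists (maxn (maxn N L) K) => i j; rewrite !geq_max.
move=> /andP[/andP[Ni Li] Ki] /andP[/andP[Nj Lj] Kj].
have := LC _ _ Li Lj; rewrite lt_min => /andP[ijb ije].
have xij : (x i).1 = (x j).1 by rewrite !xe.
by have := tail_le_level xij (lt_le_trans ijb (bI _ Ki)); lra.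
Qed.

End level.

(** The tail distance is consulted only on a common edge; this ends the recursion for threads at
    unequal digits. *)
Lemma level_ext (R : realType) (G : graph R) (Y : Type) (P : Y -> R)
    (d d' : Y -> Y -> R) (x x' y y' : edge G * Y) :
  x.1 = x'.1 -> y.1 = y'.1 -> P x.2 = P x'.2 -> P y.2 = P y'.2 ->
  (x.1 = y.1 -> d x.2 y.2 = d' x'.2 y'.2) -> level P d x y = level P d' x' y'.
Proof.
case: x x' y y' => [v a] [v' a'] [w b] [w' b'] /= <- <- Pa Pb dd.
rewrite /level /fan /collapse /node /gap /outer /inner /= Pa Pb.
by case: (asboolP (v = w)) => // /dd ->.
Qed.

(** * The connector as a space of threads *)

Section connector.
Context {R : realType}.
Local Notation S := (nat -> R * R).
Implicit Types (u v : S) (w : R * R).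

Definition first u : R := (u 0%N).1.
Definition shift u : S := fun k => u k.+1.
Definition scons w u : S := fun k => if k is k'.+1 then u k' else w.
Definition sone : S := fun=> (1, 1).

Lemma first_sone : first sone = 1. Proof. by []. Qed.

Fact diag_edist_src w : `|w.1 - (w.1, w.1).1| = 0.
Proof. by rewrite subrr normr0. Qed.

Fact diag_jump (t : R) : `|(t, t).1 - (t, t).2| = 0.
Proof. by rewrite subrr normr0. Qed.

(** Edges are compared by their sources, so that [level] dominates the difference of [first], as
    [tail_lip] requires. The restriction of the vertices to ]0, 1] is left to [digit]. *)
Definition interval_graph : graph R := @Graph R (R * R)%type R fst snd
  (fun t => (t, t)) (fun w => `|w.1 - w.2|) (fun a b => `|a.1 - b.1|)
  (fun=> erefl) (fun=> erefl) diag_jump (fun=> normr_ge0 _)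
  (fun _ _ => normr_ge0 _) diag_edist_src (fun a b => distrC a.1 b.1)
  (fun b a c => ler_distD b.1 a.1 c.1) diag_edist_src (fun=> lexx _).

Definition uncons u : edge interval_graph * S := (u 0%N, shift u).

(** Finite unfoldings of the fixed-point equation [cdistE]. *)
Fixpoint sdist n u v : R := if n is n'.+1
  then level first (sdist n') (uncons u) (uncons v) else `|first u - first v|.

Lemma sdist_tail n : tail_metric first (sdist n).
Proof.
elim: n => [|n IHn]; split=> /=.
- by move=> u; rewrite subrr normr0.
- by move=> u v; exact: distrC.
- by move=> v u t; exact: ler_distD.
- by [].
- by move=> u; exact: level_refl.
- by move=> u v; exact: level_sym.
- by move=> v u t; exact: level_tri.
- by move=> u v; exact: (edge_le_level _ _ (uncons u) (uncons v)).
Qed.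

Lemma sdist_agree n u u' v v' : (forall i, (i <= n)%N -> u i = u' i) ->
  (forall i, (i <= n)%N -> v i = v' i) -> sdist n u v = sdist n u' v'.
Proof.
elim: n u u' v v' => [|n IHn] u u' v v' uu' vv' /=.
  by rewrite /first uu' ?vv'.
apply: level_ext => [||||_]; rewrite /= ?uu' ?vv'//.
- by rewrite /first /shift uu'.
- by rewrite /first /shift vv'.
- by apply: IHn => i ni; rewrite /shift ?uu' ?vv'.
Qed.

Lemma sdist_stable n k u v : u k <> v k -> (k < n)%N ->
  sdist n u v = sdist k.+1 u v.
Proof.
elim: k n u v => [|k IHk] [|n]// u v uv kn.
  by apply: level_ext => // /uv.
by apply: level_ext => //= _; apply: IHk.
Qed.

(** By [sdist_stable], any index of unequal digits gives the same value; the default 0 serves equal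
    threads, where every [sdist] vanishes. *)
Definition cdist u v := sdist (xget 0%N [set k | u k <> v k]).+1 u v.

Lemma cdist_sdist n k u v : u k <> v k -> (k < n)%N -> cdist u v = sdist n u v.
Proof.
move=> uvk kn; rewrite /cdist; set k0 := xget _ _.
have uvk0 : u k0 <> v k0 by apply: (@xgetPex _ 0%N [set k | u k <> v k]);
  exists k.
have m0 := sdist_stable uvk0 (leq_maxl k0.+1 n).
rewrite -m0; rewrite (sdist_stable uvk kn); apply: sdist_stable uvk _.
by rewrite leq_max kn orbT.
Qed.

Lemma cdist_ev u v : exists N : nat, forall n, (N <= n)%N -> cdist u v = sdist
  n u v.
Proof.
have [[k uvk]|uv] := pselect (exists k, u k <> v k).
  by exists k.+1 => n kn; exact: cdist_sdist uvk kn.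
have -> : u = v.
  by apply/funext => k; apply: contrapT => uvk; apply: uv; exists k.
by exists 0%N => n _; rewrite /cdist !(tail_refl (sdist_tail _)).
Qed.

Lemma cdist_tail : tail_metric first cdist.
Proof.
split.
- by move=> u; exact: (tail_refl (sdist_tail _)).
- move=> u v; have [M Mn] := cdist_ev u v; have [N Nn] := cdist_ev v u.
  by rewrite (Mn _ (leq_maxl M N)) (Nn _ (leq_maxr M N)) (tail_sym (sdist_tail
    _)).
- move=> v u t; have [M Mn] := cdist_ev u v; have [N Nn] := cdist_ev v t.
  have [L Ln] := cdist_ev u t.
  have [ML NL LL] : [/\ (M <= maxn M (maxn N L))%N, (N <= maxn M (maxn N L))%N
    & (L <= maxn M (maxn N L))%N] by rewrite !leq_max !leqnn !orbT.
  by rewrite (Mn _ ML) (Nn _ NL) (Ln _ LL); exact: (tail_tri (sdist_tail _)).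
- move=> u v; have [N Nn] := cdist_ev u v.
  by rewrite (Nn N)//; exact: (tail_lip (sdist_tail _)).
Qed.

Lemma cdistE u v : cdist u v = level first cdist (uncons u) (uncons v).
Proof.
have [M Mn] := cdist_ev u v; have [N Nn] := cdist_ev (shift u) (shift v).
rewrite (Mn (maxn M N).+1) ?leqW ?leq_maxl//=.
by apply: level_ext => //= _; rewrite -Nn// leq_maxr.
Qed.

Lemma cdist_scons w u v : cdist (scons w u) (scons w v) <= cdist u v.
Proof. by rewrite cdistE; exact: level_same_le cdist_tail _ _ _. Qed.

Lemma cdist_agree u v : u <> v -> exists K : nat, forall u' v',
  (forall i, (i < K)%N -> u i = u' i) -> (forall i, (i < K)%N -> v i = v' i) ->
  cdist u v = cdist u' v'.
Proof.
move=> uv; have [k uvk] : exists k, u k <> v k.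
  apply: contrapT => H; apply: uv; apply/funext => k; apply: contrapT => uvk.
  by apply: H; exists k.
(* Depth [k.+1] reads the digits up to index [k.+1]. *)
exists k.+2 => u' v' uu' vv'; rewrite (@cdist_sdist k.+1 k)//.
rewrite (@cdist_sdist k.+1 k _ v') -?uu' -?vv'//.
by apply: sdist_agree => i ik; rewrite ?uu' ?vv'.
Qed.

(* The digit [(s, t)] of a thread [u] is an edge and [shift u] is a point of the
   copy on this edge. The digit [(t, t)] is the vertex [t] and its tail is [sone]
   by convention; [sone] itself is the vertex 1, the end of the connector. *)
Definition digit w := (0 < w.1 < 1 /\ 0 < w.2 < 1) \/ w = (1, 1).

Definition thread u := forall k,
  digit (u k) /\ ((u k).1 = (u k).2 -> u k.+1 = (1, 1)).

Lemma digit1P w : digit w -> 0 < w.1 <= 1.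
Proof.
by case=> [[/andP[w0 w1] _]|->]; rewrite ?ltr01 ?lexx// w0 ltW.
Qed.

Lemma digit2P w : digit w -> 0 < w.2 <= 1.
Proof.
by case=> [[_ /andP[w0 w1]]|->]; rewrite ?ltr01 ?lexx// w0 ltW.
Qed.

Lemma digit_eq1 w : digit w -> w.1 = 1 -> w = (1, 1).
Proof. by case=> [[/andP[_ +] _]|//] => /lt_eqF/eqP. Qed.

Lemma digit_diag t : 0 < t <= 1 -> digit (t, t).
Proof.
move=> /andP[t0]; rewrite le_eqVlt => /orP[/eqP->|t1]; first by right.
by left; rewrite /= t0 t1.
Qed.

Lemma thread_first u : thread u -> 0 < first u <= 1.
Proof. by move=> tu; exact: digit1P (tu 0%N).1. Qed.

Lemma thread_shift u : thread u -> thread (shift u).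
Proof. by move=> tu k; exact: tu. Qed.

Lemma thread_sone : thread sone.
Proof. by move=> k; split=> //; right. Qed.

Lemma thread_stop u k : thread u -> (u k).1 = (u k).2 -> shift (fun i => u (k +
  i)%N) = sone.
Proof.
move=> tu uk; apply/funext; elim=> [|i IHi]; rewrite /shift.
  by rewrite addn1; exact: (tu k).2.
rewrite addnS; apply: (tu (k + i.+1)%N).2.
by move: IHi; rewrite /shift => ->.
Qed.

Lemma thread_eq1 u : thread u -> first u = 1 -> u = sone.
Proof.
move=> tu u1; have u0 := digit_eq1 (tu 0%N).1 u1.
have := @thread_stop _ 0%N tu; rewrite u0 => /(_ erefl) H.
by apply/funext => -[|i]; [rewrite u0|rewrite -[RHS]/(sone i) -H].
Qed.

Lemma thread_scons w u : digit w -> (w.1 = w.2 -> u = sone) -> thread u ->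
  thread (scons w u).
Proof. by move=> dw wu tu [|k] //=; split=> // /wu ->. Qed.

Definition spoint t : S := scons (t, t) sone.

Lemma thread_spoint t : 0 < t <= 1 -> thread (spoint t).
Proof. by move=> t01; apply: thread_scons => //;
  [exact: digit_diag|exact: thread_sone]. Qed.

Lemma uncons_inj u v : uncons u = uncons v -> u = v.
Proof. by move=> [u0 uv]; apply/funext => -[//|k];
  exact: (congr1 (@^~ k) uv). Qed.

Lemma thread_proper u : thread u -> proper first sone (uncons u).
Proof.
move=> tu; split.
- exact: thread_first (thread_shift tu).
- move=> /= /normr0_eq0/subr0_eq u12.
  have := @thread_stop _ 0%N tu u12; rewrite /vertex /uncons /= => ->.
  by congr (_, _); rewrite [LHS]surjective_pairing -u12.
- exact: thread_eq1 (thread_shift tu).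
Qed.

Lemma cdist_le1 u v : thread u -> thread v -> cdist u v <= 1.
Proof.
move=> tu tv; rewrite cdistE; apply: level_le1.
- have := digit1P (tu 0%N).1; have := digit1P (tv 0%N).1 => /=.
  by move=> /andP[? ?] /andP[? ?]; rewrite ler_norml; apply/andP; split; lra.
- exact: thread_first (thread_shift tu).
- exact: thread_first (thread_shift tv).
Qed.

(** Each common digit halves the distance by [level_half], which asks for tails in equal position;
    hence the extra common digit. *)
Lemma cdist_prefix k u v : thread u -> thread v ->
  (forall i, (i < k.+1)%N -> u i = v i) -> cdist u v <= 2^-1 ^+ k.
Proof.
elim: k u v => [|k IHk] u v tu tv uv; first by rewrite expr0 cdist_le1.
rewrite cdistE /uncons uv//; apply: le_trans (level_half cdist_tail _ _) _.
  by rewrite /first /shift uv.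
rewrite exprS ler_pM2l// IHk//; [exact: thread_shift..|].
by move=> i ik; rewrite /shift uv.
Qed.

Lemma cdist_eq0 u v : thread u -> thread v -> cdist u v = 0 -> u = v.
Proof.
move=> tu tv uv0; apply/funext => k; elim: k u v tu tv uv0 => [|k IHk] u v tu
  tv.
  rewrite cdistE => /(level_eq0 cdist_tail first_sone); rewrite /=.
  by move=> /(_ (thread_proper tu) (thread_proper tv))[].
rewrite cdistE => /(level_eq0 cdist_tail first_sone) /=.
move=> /(_ (thread_proper tu) (thread_proper tv))[_ [d0|uv]].
  exact: IHk (thread_shift tu) (thread_shift tv) d0.
exact: (congr1 (@^~ k) uv).
Qed.

Lemma spoint_node u : thread u -> 0 < node first (uncons u) <= 1.
Proof.
move=> tu; rewrite /node; case: ifP => _ /=.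
  exact: digit1P (tu 0%N).1.
exact: digit2P (tu 0%N).1.
Qed.

End connector.

(** * Small powers and reciprocals, and locally constant functions on an interval *)

Lemma half_pow_lt (R : realType) (e : R) : 0 < e -> exists k : nat, 2^-1 ^+ k <
  e.
Proof.
move=> e0; exists (Num.bound e^-1).
have := archi_boundP (ltW (_ : 0 < e^-1)); rewrite invr_gt0 => /(_ e0) eb.
rewrite exprVn invf_plt ?posrE ?exprn_gt0//; apply: lt_le_trans eb _.
by rewrite -natrX ler_nat ltnW// ltn_expl.
Qed.

Lemma natSinv_lt (R : realType) (e : R) : 0 < e -> exists n : nat, n.+1%:R^-1 <
  e.
Proof.
move=> e0; exists (Num.bound e^-1); rewrite invf_plt ?posrE//.
have := archi_boundP (ltW (_ : 0 < e^-1)); rewrite invr_gt0 => /(_ e0).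
by move=> /lt_le_trans; apply; rewrite ler_nat.
Qed.

(** Composed with the retraction [clamp] of the line onto the interval, [f] has open fibers, and the
    line is connected. *)
Lemma locally_constant_interval (R : realType) (B : Type) (f : R -> B) :
  (forall t, 0 <= t <= 1 -> exists2 c : R, 0 < c &
    forall s, 0 <= s <= 1 -> `|t - s| < c -> f s = f t) ->
  forall t, 0 <= t <= 1 -> f t = f 0.
Proof.
move=> fl; pose clamp (t : R) := Num.max 0 (Num.min 1 t).
have clamp01 t : 0 <= clamp t <= 1.
  by rewrite /clamp le_max lexx/= ge_max ler01 ge_min lexx.
have clampE t : 0 <= t <= 1 -> clamp t = t.
  by move=> /andP[t0 t1]; rewrite /clamp min_r ?max_r.
have clampL t s : `|clamp t - clamp s| <= `|t - s|.
  rewrite /clamp; case: (leP 1 t) => ht; case: (leP 1 s) => hs;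
    rewrite ?(max_r (@ler01 R)) ?subrr ?normr0 ?normr_ge0//.
  - by case: (leP 0 s) => s0; rewrite !ger0_norm; lra.
  - by case: (leP 0 t) => t0; rewrite !ler0_norm; lra.
  - case: (leP 0 s) => s0; case: (leP 0 t) => t0 //.
    + by rewrite sub0r normrN ger0_norm// ler0_norm; lra.
    + by rewrite subr0 !ger0_norm; lra.
    + by rewrite subrr normr0.
have cvxR : connected [set: R] by apply/connected_intervalP => ? ? _ _ ? _.
pose A := [set t | f (clamp t) = f (clamp 0)].
have opn (D : set B) : open [set t | D (f (clamp t))].
  rewrite openE => t /= Dt; have [c c0 fc] := fl _ (clamp01 t).
  apply/nbhs_ballP; exists c => //= s; rewrite /ball/= => ts.
  by rewrite fc//; exact: le_lt_trans (clampL _ _) ts.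
have AT : A = [set: R].
  apply: cvxR.
  - by exists 0.
  - by exists A; [exact: (opn [set f (clamp 0)])|rewrite setTI].
  - exists A; last by rewrite setTI.
    by rewrite -openC; exact: (opn [set y | y <> f (clamp 0)]).
move=> t t01; have : A t by rewrite AT.
by rewrite /A/= !clampE// lexx ler01.
Qed.

(** * Completeness, truncations and connectedness of the connector *)

Section connector_topology.
Context {R : realType}.
Local Notation S := (nat -> R * R).
Implicit Types (u v : S) (w : R * R).

Lemma iter_shift k u i : iter k shift u i = u (k + i)%N.
Proof. by elim: k i => //= k IHk i; rewrite /shift IHk addnS. Qed.

Lemma thread_iter k u : thread u -> thread (iter k shift u).
Proof. by move=> tu; elim: k => //= k; exact: thread_shift. Qed.

Lemma sconsK u : scons (u 0%N) (shift u) = u.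
Proof. by apply/funext => -[]. Qed.

Lemma thread_diag u : thread u -> (u 0%N).1 = (u 0%N).2 -> u = spoint (u 0%N).1.
Proof.
move=> tu u12; apply: uncons_inj; have [_ H _] := thread_proper tu.
by rewrite H//= u12 subrr normr0.
Qed.

(** By [level_cauchy], a Cauchy sequence without limit has an eventually constant first digit and
    tails of the same kind. Iteration yields a thread sharing ever longer prefixes with the
    sequence, a limit by [cdist_prefix]. *)
Lemma cdist_complete (x : nat -> S) : (forall n, thread (x n)) ->
  cauchy_for cdist x -> exists2 l, thread l & cvg_for cdist x l.
Proof.
move=> tx xC; apply: contrapT => xl.
pose y k n := iter k shift (x n).
have ty k n : thread (y k n) by exact: thread_iter.
pose Inv k := cauchy_for cdist (y k) /\
  ~ exists2 l, thread l & cvg_for cdist (y k) l.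
have step k : Inv k -> Inv k.+1 /\ exists w, [/\ digit w, w.1 <> w.2 &
    exists N : nat, forall m, (N <= m)%N -> x m k = w].
  move=> [yC yl].
  have nondiag n : uncons (y k n) <> vertex sone (src (uncons (y k n)).1) ->
      (y k n 0%N).1 <> (y k n 0%N).2.
    move=> H e; apply: H; rewrite {1}(thread_diag (ty k n) e).
    by rewrite /vertex /uncons /=.
  have lC : cauchy_for (level first cdist) (fun n => uncons (y k n)).
    by move=> e /yC[N NC]; exists N => m n Nm Nn; rewrite -cdistE; exact: NC.
  case: (level_cauchy cdist_tail first_sone (fun n => thread_proper (ty k n))
    lC).
  - move=> [n nl]; exfalso; apply: yl.
    exists (spoint (node first (uncons (y k n)))).
      by apply: thread_spoint; exact: spoint_node.
    by move=> e /nl[N NC]; exists N => m Nm; rewrite cdistE; exact: NC.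
  - move=> [n [/nondiag nd nl]]; exfalso; apply: yl.
    exists (scons (y k n 0%N) sone).
      by apply: thread_scons => //; [exact: (ty k n 0%N).1|exact: thread_sone].
    by move=> e /nl[N NC]; exists N => m Nm; rewrite cdistE; exact: NC.
  - move=> [n [/nondiag nd [N NE] tC]]; split; last first.
      exists (y k n 0%N); split => //; first exact: (ty k n 0%N).1.
      by exists N => m Nm; have := NE _ Nm; rewrite /= /y !iter_shift addn0.
    split; first exact: tC.
    move=> [l tl ll]; apply: yl; exists (scons (y k n 0%N) l).
      by apply: thread_scons => //; exact: (ty k n 0%N).1.
    move=> e /ll[M MC]; exists (maxn M N) => m; rewrite geq_max => /andP[Mm Nm].
    rewrite -(sconsK (y k m)); have /= -> := NE _ Nm.
    exact: le_lt_trans (cdist_scons _ _ _) (MC _ Mm).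
have InvA k : Inv k by elim: k => [|k /step[]]//; split.
have /choice[u uP] k := (step k (InvA k)).2.
have tu : thread u by move=> k; have [? ? _] := uP k.
have pre k : exists N : nat, forall n, (N <= n)%N -> forall i, (i < k)%N -> x n
  i = u i.
  elim: k => [|k [N NE]]; first by exists 0%N.
  have [_ _ [M ME]] := uP k; exists (maxn M N) => n.
  rewrite geq_max => /andP[Mn Nn] i; rewrite ltnS leq_eqVlt => /orP[/eqP->|].
    exact: ME.
  exact: NE.
apply: xl; exists u => // e /half_pow_lt[k ke]; have [N NE] := pre k.+1.
exists N => n Nn; apply: le_lt_trans ke.
by apply: cdist_prefix => // i ik; exact: NE.
Qed.

(* Up to finitely many digits, a limit of threads of a set [D] is one of the
   truncations [approx j b u] for [u] in [D]. *)
Fixpoint approx j (b : bool) u : S := if j is j'.+1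
  then scons (u 0%N) (approx j' b (shift u))
  else if b then spoint (node first (uncons u)) else sone.

(** The outcomes of [level_near] are truncation at a vertex, truncation at the end of an edge, and
    recursion into the tail. *)
Lemma approx_near k u : thread u -> exists2 c : R, 0 < c &
  forall v, cdist u v < c ->
    exists j b, forall i, (i < k)%N -> u i = approx j b v i.
Proof.
elim: k u => [|k IHk] u tu; first by exists 1 => // v _; exists 0%N, true.
have [c c0 cP] := IHk _ (thread_shift tu).
have [c' c'0 c'P] := level_near cdist first_sone (thread_proper tu) c0.
exists c' => // v; rewrite cdistE => /c'P[uv|[/= uv [us|/cP[j [b jb]]]]].
- exists 0%N, true => i _ /=; congr (_ i); apply: uncons_inj.
  by rewrite {}uv.
- exists 1%N, false => i _ /=; congr (_ i); apply: uncons_inj.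
  by rewrite /uncons uv us.
- by exists j.+1, b => -[_|i ik]//=; rewrite -jb.
Qed.

Variable B : Type.

(* [h] is continuous on the thread space completed by an origin, of image [h0],
   in which the threads with [first] near 0, resp. near 1, are close to the
   origin, resp. to [sone]. *)
Definition locally_constant (h : S -> B) (h0 : B) := [/\
  (forall u, thread u -> exists2 c : R, 0 < c &
    forall v, thread v -> cdist u v < c -> h v = h u),
  (exists2 c : R, 0 < c & forall v, thread v -> first v < c -> h v = h0) &
  (exists2 c : R, 0 < c & forall v, thread v -> 1 - first v < c -> h v = h
    sone)].

Lemma cdist_spoint w v : thread v -> first v < 4^-1 ->
  cdist (spoint w.1) (scons w v) <= first v.
Proof.
move=> tv v4; rewrite (tail_sym cdist_tail) cdistE.
apply: (level_start cdist first_sone (w : edge interval_graph)).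
by rewrite v4 andbT; have /andP[] := thread_first tv.
Qed.

Lemma cdist_end w : `|w.1 - w.2| < 4^-1 ->
  cdist (spoint w.2) (scons w sone) <= `|w.1 - w.2|.
Proof.
move=> w4; rewrite (tail_sym cdist_tail) cdistE.
exact: (@level_end _ interval_graph _ _ cdist _ first_sone w w4).
Qed.

Lemma spoint1 : spoint 1 = sone :> S.
Proof. by apply/funext => -[]. Qed.

(** The copy on the edge [w] has its origin glued to the vertex [w.1]. *)
Lemma locally_constant_scons h h0 w : locally_constant h h0 ->
  digit w -> w.1 <> w.2 ->
  locally_constant (fun u => h (scons w u)) (h (spoint w.1)).
Proof.
move=> [hl _ _] dw w12.
have tw v : thread v -> thread (scons w v) by move=> tv; exact: thread_scons.
split.
- move=> u tu; have [c c0 cP] := hl _ (tw _ tu); exists c => // v tv uv.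
  by apply: cP; [exact: tw|exact: le_lt_trans (cdist_scons _ _ _) uv].
- have [c c0 cP] := hl _ (thread_spoint (digit1P dw)).
  exists (Num.min c 4^-1); first by rewrite lt_min; lra.
  move=> v tv; rewrite lt_min => /andP[vc v4]; apply: cP; first exact: tw.
  exact: le_lt_trans (cdist_spoint _ _ _) vc.
- have [c c0 cP] := hl _ (tw _ thread_sone).
  exists c => // v tv vc; apply: cP; first exact: tw.
  rewrite (tail_sym cdist_tail) cdistE; apply: le_lt_trans vc.
  by apply: level_near1 => //; exact: thread_first.
Qed.

(** Constancy on copies makes [h] a function of vertices. The copy on the edge [(s, t)] has the
    value at [s] and an end close to [t], so this function is locally constant on the interval. *)
Lemma locally_constant_base h h0 : locally_constant h h0 ->
  (forall w u, digit w -> w.1 <> w.2 -> thread u -> h (scons w u) = h (spoint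
    w.1)) ->
  forall u, thread u -> h u = h0.
Proof.
move=> [hl [c0 c00 c0P] [c1 c10 c1P]] hw.
(* The value at 0 is that of the origin, which is not a thread. *)
pose f (t : R) := if t <= 0 then h0 else h (spoint t).
have fE t : 0 < t -> f t = h (spoint t) by rewrite /f leNgt => ->.
have f0 : f 0 = h0 by rewrite /f lexx.
have fc t : 0 <= t <= 1 -> f t = h0.
  rewrite -f0; apply: locally_constant_interval => {}t /andP[].
  rewrite le_eqVlt => /orP[/eqP <- _|t0].
    exists c0 => // s /andP[s0 s1]; rewrite sub0r normrN ger0_norm// => sc.
    move: s0; rewrite le_eqVlt => /orP[/eqP<-//|s0].
    by rewrite fE// f0; apply: c0P => //; apply: thread_spoint; rewrite s0 s1.
  rewrite le_eqVlt => /orP[/eqP ->|t1].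
    exists (Num.min c1 1); first by rewrite lt_min c10 ltr01.
    move=> s /andP[s0 s1]; rewrite lt_min ger0_norm ?subr_ge0// => /andP[sc
      s1'].
    have {}s0 : 0 < s by lra.
    by rewrite !fE// spoint1; apply: c1P => //; apply: thread_spoint;
      rewrite s0 s1.
  have t01 : 0 < t <= 1 by rewrite t0 ltW.
  have [c cp cP] := hl _ (thread_spoint t01).
  exists (Num.min (Num.min c 4^-1) (Num.min t (1 - t))).
    by rewrite !lt_min cp t0/= subr_gt0 t1 invr_gt0 ltr0n.
  move=> s _; rewrite !lt_min distrC => /andP[/andP[sc s4] /andP[st st1]].
  have [->//|/eqP ts] := eqVneq s t.
  have /andP[s0 s1] : 0 < s < 1.
    by move: st st1; rewrite !ltr_norml => /andP[? ?] /andP[? ?]; apply/andP;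
      split; lra.
  have ds : digit (s, t) by left; rewrite /= s0 s1 t0 t1.
  rewrite !fE// -(hw _ _ ds ts thread_sone); apply: cP.
    by apply: thread_scons => //; exact: thread_sone.
  exact: le_lt_trans (@cdist_end (s, t) s4) sc.
move=> u tu; have /andP[u0 u1] := thread_first tu.
have -> : h u = h (spoint (first u)).
  have [u12|u12] := pselect ((u 0%N).1 = (u 0%N).2).
    by rewrite {1}(thread_diag tu u12).
  by rewrite -{1}(sconsK u); apply: hw => //;
    [exact: (tu 0%N).1|exact: thread_shift].
by rewrite -fE// fc// (ltW u0) u1.
Qed.

(* Were [h] not constant, [locally_constant_base] would give nested copies
   [scons w0 (scons w1 ...)] on which [h] is not constant; but [h] is locally
   constant at the limit thread [w0, w1, ...]. *)
Lemma locally_constant_constant h h0 : locally_constant h h0 ->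
  forall u, thread u -> h u = h0.
Proof.
move=> hl u0 tu0; apply: contrapT => hu0.
pose bad (p : (S -> B) * B) :=
  locally_constant p.1 p.2 /\ exists2 u, thread u & p.1 u <> p.2.
have next (p : {p | bad p}) : exists w, [/\ digit w, w.1 <> w.2 &
    bad ((fun u => (sval p).1 (scons w u)), (sval p).1 (spoint w.1))].
  case: p => -[g g0] [/= gl [u tu gu]]; apply: contrapT => H; apply: gu.
  apply: (locally_constant_base gl) => // w v dw w12 tv.
  apply: contrapT => gwv; apply: H; exists w; split => //.
  by split; [exact: locally_constant_scons gl dw w12|exists v].
have {next}/choice[W WP] := next.
pose nxt (p : {p | bad p}) : {p | bad p} :=
  let: And3 _ _ H := WP p in exist bad _ H.
have nxtE p v : (sval (nxt p)).1 v = (sval p).1 (scons (W p) v).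
  by rewrite /nxt; case: (WP p).
have nxtE0 p : (sval (nxt p)).2 = (sval p).1 (spoint (W p).1).
  by rewrite /nxt; case: (WP p).
have bad0 : bad (h, h0) by split=> //; exists u0.
pose st k := iter k nxt (exist bad _ bad0).
pose u k := W (st k).
have du k : digit (u k) /\ (u k).1 <> (u k).2 by have [] := WP (st k).
have tu : thread u by move=> k; have [? ?] := du k.
(* [pcat k] embeds the connector as the [k]-fold nested copy along [u]. *)
pose pcat k v : S := fun i => if (i < k)%N then u i else v (i - k)%N.
have pcatS k v : pcat k (scons (u k) v) = pcat k.+1 v.
  apply/funext => i; rewrite /pcat ltnS; case: (ltngtP i k) => //= ik.
    by rewrite -(subnSK ik).
  by rewrite ik subnn.
have tpcat k v : thread v -> thread (pcat k v).
  elim: k v => [|k IHk] v tv.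
    by rewrite (_ : pcat 0%N v = v)//; apply/funext => i; rewrite /pcat subn0.
  by rewrite -pcatS; apply/IHk/thread_scons => //; have [] := du k.
have stE k v : (sval (st k)).1 v = h (pcat k v).
  elim: k v => [|k IHk] v.
    by congr h; apply/funext => i; rewrite /pcat subn0.
  by rewrite /st iterS nxtE -/(st k) IHk -/(u k) pcatS.
have [hc _ _] := hl; have [c cp cP] := hc _ tu.
have [k kc] := half_pow_lt cp.
(* At this depth, both a point of the copy and its origin, a vertex of the copy one level up, share
   [k.+1] digits with [u]. *)
have [_ [v tv]] := svalP (st k.+2).
rewrite stE /st iterS nxtE0 -/(st k.+1) stE -/(u k.+1); apply.
have near j v' : (k < j)%N -> thread v' -> h (pcat j v') = h u.
  move=> kj tv'; apply: cP; first exact: tpcat.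
  apply: le_lt_trans kc; apply: cdist_prefix => [//||i ik].
    exact: tpcat.
  by rewrite /pcat (leq_trans ik).
by rewrite !near//; apply: thread_spoint; apply: digit1P; have [] := du k.+1.
Qed.

End connector_topology.

(** * The graph of convergent sequences and its points *)

Section cobweb.
Context {R : realType} {X : topologicalType}.
Local Notation S := (nat -> R * R).
Local Notation V := ((nat -> X) * X)%type.
Implicit Types v : V.

Definition cob_tgt (e : V * option (V * nat)) : V :=
  if e.2 is Some (v, _) then v else e.1.

Definition cob_jump (e : V * option (V * nat)) : R :=
  if e.2 is Some (_, n) then n.+1%:R^-1 else 0.

Fact cob_jump_ge0 e : 0 <= cob_jump e.
Proof. by rewrite /cob_jump; case: e.2 => [[_ n]|]//; rewrite invr_ge0. Qed.

Fact add0r_le : (0 : R) <= 0 + 0. Proof. by rewrite addr0. Qed.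

(* The vertex [(s, b)] is a sequence [s] with a limit [b], and [(v, Some (v', n))]
   is an edge from [v] to [v'], for [v] with limit [v'.1 n]. *)
Definition cob_graph : graph R := @Graph R (V * option (V * nat))%type V
  fst cob_tgt (fun v => (v, None)) cob_jump (fun _ _ => 0) (fun=> erefl) (fun=> erefl)
  (fun=> erefl) cob_jump_ge0 (fun _ _ => lexx _) (fun=> erefl)
  (fun _ _ => erefl) (fun _ _ _ => add0r_le) (fun=> erefl) cob_jump_ge0.

(** Convergence and incidence are imposed here on points, since the graph itself has all pairs
    [(s, b)] as vertices. *)
Definition cob_point (p : edge cob_graph * S) := [/\
  p.1.1.1 @ \oo --> p.1.1.2,
  if p.1.2 is Some (v, n) then v.1 @ \oo --> v.2 /\ v.1 n = p.1.1.2
    else p.2 = sone &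
  thread p.2].

Lemma cob_proper p : cob_point p -> proper first sone p.
Proof.
move=> [_ pN tp]; split.
- exact: thread_first.
- case: p pN {tp} => -[v [[v' n]|]] u /= pN; last by rewrite pN.
  by rewrite /cob_jump /= => /eqP; rewrite invr_eq0 pnatr_eq0.
- exact: thread_eq1.
Qed.

Lemma cob_point_vertex v : v.1 @ \oo --> v.2 -> cob_point (@vertex _ cob_graph
  _ sone v).
Proof. by move=> vv; split=> //; exact: thread_sone. Qed.

Lemma cob_point_node p : cob_point p -> cob_point (vertex sone (node first p)).
Proof.
move=> [p1 p2 _]; apply: cob_point_vertex; rewrite /node; case: ifP => _ //=.
by rewrite /cob_tgt; case: p.1.2 p2 => [[v n] []|].
Qed.

Lemma cob_point_edge p u : cob_point p -> p <> vertex sone (src p.1) ->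
  thread u -> cob_point (p.1, u).
Proof.
by case: p => -[v [[v' n]|]] a [/= p1 p2 tp] pv tu; split=> //; case: pv;
  rewrite p2.
Qed.

Lemma cob_complete (x : nat -> edge cob_graph * S) : (forall n, cob_point (x
  n)) ->
  cauchy_for (level first cdist) x ->
  exists2 l, cob_point l & cvg_for (level first cdist) x l.
Proof.
move=> px xC.
case: (level_cauchy cdist_tail first_sone (fun n => cob_proper (px n)) xC).
- by move=> [n nl]; exists (vertex sone (node first (x n))) => //;
    exact: cob_point_node.
- move=> [n [nv nl]]; exists ((x n).1, sone) => //.
  by apply: cob_point_edge => //; exact: thread_sone.
- move=> [n [nv [N NE] tC]].
  have [|l tl ll] := cdist_complete _ tC; first by move=> m; have [] := px m.
  exists ((x n).1, l); first exact: cob_point_edge.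
  move=> e /ll[M MC]; exists (maxn M N) => m; rewrite geq_max => /andP[Mm Nm].
  rewrite (surjective_pairing (x m)) (NE _ Nm).
  exact: le_lt_trans (level_same_le cdist_tail _ _ _) (MC _ Mm).
Qed.

(** The truncations one level above [approx], with [None] for truncation at a vertex; the index set
    is countable. *)
Definition cob_approx (i : option (nat * bool)) (p : edge cob_graph * S) :
    edge cob_graph * S :=
  if i is Some (j, b) then (p.1, approx j b p.2) else vertex sone (node first
    p).

Lemma cob_approx_near k p : cob_point p -> exists2 c : R, 0 < c &
  forall q, level first cdist p q < c -> exists i, p.1 = (cob_approx i q).1 /\
    forall m, (m < k)%N -> p.2 m = (cob_approx i q).2 m.
Proof.
move=> pp; have [_ _ tp] := pp; have [c c0 cP] := approx_near k tp.
have [c' c'0 c'P] := level_near cdist first_sone (cob_proper pp) c0.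
exists c' => // q /c'P[pE|[pq [pE|/cP[j [b jb]]]]].
- by exists None; rewrite [p]pE.
- by exists (Some (0%N, false)); rewrite /= pq pE.
- by exists (Some (j, b)).
Qed.

Lemma cob_level_agree (p q : edge cob_graph * S) : p <> q ->
  exists K : nat, forall p' q',
  p.1 = p'.1 -> (forall m, (m < K)%N -> p.2 m = p'.2 m) ->
  q.1 = q'.1 -> (forall m, (m < K)%N -> q.2 m = q'.2 m) ->
  level first cdist p q = level first cdist p' q'.
Proof.
case: p q => [e u] [f v] /= pq.
have [ef|ef] := pselect (e = f); last first.
  (* On unequal edges the tails enter only through their positions, that is, one digit. *)
  exists 1%N => p' q' pp' up' qq' vq'; apply: level_ext => //=.
    by rewrite /first up'.
  by rewrite /first vq'.
have [|K KP] := @cdist_agree _ u v; first by move=> uv; apply: pq;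
  rewrite ef uv.
exists K.+1 => p' q' pp' up' qq' vq'; apply: level_ext => //= [||_].
- by rewrite /first up'.
- by rewrite /first vq'.
- by apply: KP => i iK; [apply: up'|apply: vq']; exact: ltnW.
Qed.

End cobweb.

(** * The cobweb as a metric space *)

Section cobweb_space.
Variables (R : realType) (X : topologicalType).
Local Notation S := (nat -> R * R).
Local Notation G := (@cob_graph R X).

Record cobweb := Cobweb { cob_val : edge G * S; cob_valP : cob_point cob_val }.

HB.instance Definition _ := gen_eqMixin cobweb.
HB.instance Definition _ := gen_choiceMixin cobweb.

Let dist (a b : cobweb) : R := level first cdist (cob_val a) (cob_val b).

Lemma cob_val_inj (a b : cobweb) : cob_val a = cob_val b -> a = b.
Proof.
by case: a b => [p pp] [q pq] /= pqE; subst q; congr Cobweb;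
  exact: Prop_irrelevance.
Qed.

Let dist_refl a : dist a a = 0.
Proof. exact: (level_refl cdist_tail). Qed.

Let dist_eq0 a b : dist a b = 0 -> a = b.
Proof.
move=> ab0; apply: cob_val_inj.
have [e1] := level_eq0 cdist_tail first_sone (cob_proper (cob_valP a))
  (cob_proper (cob_valP b)) ab0.
rewrite (surjective_pairing (cob_val a)) (surjective_pairing (cob_val b)) e1.
case=> /= [|-> //]; have [_ _ ta] := cob_valP a; have [_ _ tb] := cob_valP b.
by move=> /(cdist_eq0 ta tb) ->.
Qed.

Let dist_sym a b : dist a b = dist b a.
Proof. exact: (level_sym cdist_tail). Qed.

Let dist_tri b a c : dist a c <= dist a b + dist b c.
Proof. exact: (level_tri cdist_tail). Qed.

HB.instance Definition _ := @isMetric.Build R cobweb dist dist_refl dist_eq0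
  dist_sym dist_tri.

End cobweb_space.

(** * Properties of the cobweb and of its map to [X] *)

Section cobweb_theory.
Variables (R : realType) (X : topologicalType).
Local Notation S := (nat -> R * R).
Local Notation G := (@cob_graph R X).
Local Notation E := (cobweb R X).
Local Notation cvertex v := (@vertex R G S sone v).
Implicit Types a b : E.

Lemma cobweb_mdist a b : mdist a b = level first cdist (cob_val a) (cob_val b)
  :> R.
Proof. by []. Qed.

(** Centers of balls of radius [2^-1 ^+ n] in [F] form a Cauchy sequence, whose limit is a limit of
    [F]. *)
Lemma cobweb_complete : complete_space E.
Proof.
move=> F PF /cauchyP FC.
have /choice[x xF] (n : nat) : exists x : E, F (ball x (2^-1 ^+ n : R)).
  by apply: FC; rewrite exprn_gt0.
have xd m n : mdist (x m) (x n) < 2^-1 ^+ m + 2^-1 ^+ n :> R.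
  have [y []] := filter_ex (filterI (xF m) (xF n)).
  rewrite !ballEmdist /= => xmy xny.
  apply: le_lt_trans (metric_triangle _ y _) _; rewrite (metric_sym y);
    exact: ltrD.
have xC : cauchy_for (level first cdist) (fun n => cob_val (x n)).
  move=> e e0; have e20 : 0 < e / 2 by rewrite divr_gt0.
  have [N Ne] := half_pow_lt e20; exists N => m n Nm Nn.
  have le2 k : (N <= k)%N -> 2^-1 ^+ k <= 2^-1 ^+ N :> R.
    by move=> Nk; apply: ler_wiXn2l => //; rewrite invf_le1// ler1n.
  by rewrite -cobweb_mdist; have := xd m n; have := le2 m Nm;
    have := le2 n Nn; lra.
have [l pl ll] := cob_complete (fun n => cob_valP (x n)) xC.
exists (Cobweb pl) => A /nbhs_ballP[e /= e0 eA].
have e20 : 0 < e / 2 by rewrite divr_gt0.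
have [N NP] := ll _ e20; have [M Me] := half_pow_lt e20.
apply: filterS (xF (maxn M N)) => y; rewrite ballEmdist /= => xy.
apply: eA; rewrite ballEmdist /=.
apply: le_lt_trans (metric_triangle _ (x (maxn M N)) _) _.
rewrite metric_sym cobweb_mdist; have := NP _ (leq_maxr M N) => /=.
have : 2^-1 ^+ maxn M N <= 2^-1 ^+ M :> R.
  by apply: ler_wiXn2l; rewrite ?leq_maxl// invf_le1// ler1n.
by move: xy; rewrite cobweb_mdist; lra.
Qed.

(** Every distance in [A] is a value of [g] at two points of [D] and two truncation codes;
    [card_square] and the countability of the codes bound their number. *)
Lemma cobweb_economical : economical E.
Proof.
move=> A Ainf.
have [|D AD Dmin] := @min_card E [set D | dense_in A D].
  by exists A; split=> //; exact: subset_closure.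
exists D => //; have [DA AclD] := AD.
have Dinf : infinite_set D.
  move=> Dfin; apply: Ainf; apply: (sub_finite_set _ Dfin).
  have /accessible_finite_set_closed := hausdorff_accessible (@metric_hausdorff
    R E).
  by move=> /(_ _ Dfin) clD; exact: subset_trans AclD clD.
pose I := option (nat * bool).
pose g (z : (E * E) * (I * I)) : R := level first cdist
  (cob_approx z.2.1 (cob_val z.1.1)) (cob_approx z.2.2 (cob_val z.1.2)).
have apprx k a : A a -> exists2 d : E, D d & exists i,
    (cob_val a).1 = (cob_approx i (cob_val d)).1 /\
    forall m, (m < k)%N -> (cob_val a).2 m = (cob_approx i (cob_val d)).2 m.
  move=> Aa; have [c c0 cP] := cob_approx_near k (cob_valP a).
  have [d [Dd]] := AclD _ Aa _ (nbhsx_ballx a _ c0).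
  by rewrite ballEmdist /= cobweb_mdist => /cP[i]; exists d => //; exists i.
have sub : [set mdist p.1 p.2 | p in A `*` A] `<=` g @` ((D `*` D) `*` [set: I
  * I]).
  move=> _ [[a b] [/= Aa Ab] <-]; rewrite cobweb_mdist.
  have [->|/eqP ab] := eqVneq a b.
    have [d Dd _] := apprx 0%N a Aa; exists ((d, d), (None, None)) => //.
    by rewrite /g /= !(level_refl cdist_tail).
  have [|K KP] := @cob_level_agree R X (cob_val a) (cob_val b).
    by move=> /cob_val_inj.
  have [d Dd [i [i1 i2]]] := apprx K a Aa;
    have [d' Dd' [i' [i'1 i'2]]] := apprx K b Ab.
  by exists ((d, d'), (i, i')) => //; rewrite /g /= -KP.
apply: card_le_trans (subset_card_le sub) _.
apply: card_le_trans (card_image_le _ _) _.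
have [x0 Dx0] := infinite_setN0 Dinf.
have Dsq := card_square Dinf.
have ID : ([set: I * I] #<= D)%card.
  by apply: card_le_trans (countableP _) _; exact/infiniteP.
have [f fD finj] := card_le_ex_inj x0 Dsq.
have [h hD hinj] := card_le_ex_inj x0 ID.
apply: card_le_trans _ Dsq.
apply: (@card_le_inj _ _ _ _ (fun z => (f z.1, h z.2))).
  by move=> [z i] [/= Dz _]; split=> /=; [exact: fD|exact: hD].
move=> [z i] [z' i'] [/= Dz _] [/= Dz' _] [/finj -> // /hinj -> //].
Qed.

Definition cob_map a : X := (cob_val a).1.1.2.

Definition cob_vertex (s : nat -> X) (x : X) (sx : s @ \oo --> x) : E :=
  Cobweb (@cob_point_vertex R X (s, x) sx).

Lemma cob_map_surj : set_surj [set: E] [set: X] cob_map.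
Proof. by move=> x _; exists (cob_vertex (cvg_cst x)). Qed.

Lemma cob_jump_end (v v' : (nat -> X) * X) (n : nat) : n.+1%:R^-1 < 4^-1 :> R ->
  level first cdist (cvertex v') ((v, Some (v', n)) : edge G, sone) <=
    n.+1%:R^-1.
Proof.
move=> n4; rewrite (level_sym cdist_tail).
exact: (@level_end _ G _ _ cdist _ first_sone (v, Some (v', n)) n4).
Qed.

(** Connectedness of the connector carries the value along each edge to its source vertex, and edges
    of small jump carry it from there to the constant sequence. *)
Lemma cob_fiber_constant (x : X) (H : edge G * S -> Prop) :
  (forall p, cob_point p -> p.1.1.2 = x -> exists2 c : R, 0 < c &
    forall q, cob_point q -> q.1.1.2 = x -> level first cdist p q < c -> H q =
      H p) ->
  forall p, cob_point p -> p.1.1.2 = x -> H p = H (cvertex (cst x, x)).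
Proof.
move=> Hl.
have edge_const p u : cob_point p -> p.1.1.2 = x ->
    p <> vertex sone (src p.1) -> thread u -> H (p.1, u) = H (vertex sone (src
      p.1)).
  move=> pp px pv; have pu t : thread t -> cob_point (p.1, t) by exact:
    cob_point_edge.
  have ps : cob_point (vertex sone (src p.1)).
    by apply: cob_point_vertex; have [] := pp.
  move: u; apply: (locally_constant_constant (h := fun u => H (p.1, u))); split.
  - move=> u tu; have [c c0 cP] := Hl _ (pu _ tu) px; exists c => // t tt ut.
    apply: cP => //; first exact: pu.
    exact: le_lt_trans (level_same_le cdist_tail _ _ _) ut.
  - have [c c0 cP] := Hl _ ps px.
    exists (Num.min c 4^-1); first by rewrite lt_min; lra.
    move=> t tt; rewrite lt_min => /andP[tc t4]; apply: cP => //;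
      first exact: pu.
    rewrite (level_sym cdist_tail); apply: le_lt_trans (level_start _
      first_sone _ _) tc.
    by rewrite t4 andbT; have /andP[] := thread_first tt.
  - have [c c0 cP] := Hl _ (pu _ thread_sone) px.
    exists c => // t tt tc; apply: cP => //; first exact: pu.
    rewrite (level_sym cdist_tail); apply: le_lt_trans (level_near1 _ _ _ _) tc
      => //.
    exact: thread_first.
have vertex_const v : v.1 @ \oo --> v.2 -> v.2 = x ->
    H (cvertex v) = H (cvertex (cst x, x)).
  (* Such an edge exists for all [n], every term of the constant sequence being [x]. *)
  move=> vv vx; pose e n : edge G := (v, Some ((cst x, x), n)).
  have pe n : cob_point (e n, sone).
    by split=> //=; [split=> //; exact: cvg_cst|exact: thread_sone].
  have cx : cob_point (cvertex (cst x, x)) by apply: cob_point_vertex;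
    exact: cvg_cst.
  have [c c0 cP] := Hl _ cx erefl.
  have m0 : 0 < Num.min c 4^-1 by rewrite lt_min; lra.
  have [n] := natSinv_lt m0; rewrite lt_min => /andP[nc n4].
  rewrite -(edge_const (e n, sone) sone)//; last exact: thread_sone.
  by apply: cP; [exact: pe|exact: vx|exact: le_lt_trans (cob_jump_end _ _ n4)
    nc].
move=> p pp px; have [pv|pv] := pselect (p = vertex sone (src p.1)).
  by rewrite [p in LHS]pv; apply: vertex_const => //; have [] := pp.
rewrite (surjective_pairing p) edge_const//; last by have [] := pp.
by apply: vertex_const => //; have [] := pp.
Qed.

Lemma cob_map_monotone : monotone_map cob_map.
Proof.
split; first exact: cob_map_surj.
move=> x B [a Ba] [C1 oC1 BC1] [C2 cC2 BC2].
have FB b : cob_map b = x -> B b <-> C1 b.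
  by move=> bx; rewrite BC1; split=> [[]|].
(* Membership in the clopen part of the fiber becomes a [Prop]-valued locally constant function on
   raw pairs. *)
pose H p := exists pp : cob_point p, C1 (Cobweb pp).
have HE b : H (cob_val b) = C1 b.
  apply/propext; split=> [[pp]|C1b]; last first.
    by exists (cob_valP b); move: C1b; congr C1; exact: cob_val_inj.
  by congr C1; exact: cob_val_inj.
have Hl p : cob_point p -> p.1.1.2 = x -> exists2 c : R, 0 < c &
    forall q, cob_point q -> q.1.1.2 = x -> level first cdist p q < c -> H q =
      H p.
  move=> pp px; pose b := Cobweb pp; have bx : cob_map b = x by [].
  have [C1b|C1b] := pselect (C1 b).
    have /nbhs_ballP[c /= c0 cC] := open_nbhs_nbhs (conj oC1 C1b).
    exists c => // q pq qx bq; rewrite -[q]/(cob_val (Cobweb pq)) -[p]/(cob_val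
      b) !HE.
    apply/propext; split=> // _; apply: cC; rewrite ballEmdist; exact: bq.
  have oC2 : open (~` C2) by rewrite openC.
  have C2b : (~` C2) b by move=> C2b; apply: C1b; apply/(FB _ bx); rewrite BC2.
  have /nbhs_ballP[c /= c0 cC] := open_nbhs_nbhs (conj oC2 C2b).
  exists c => // q pq qx bq; rewrite -[q]/(cob_val (Cobweb pq)) -[p]/(cob_val
    b) !HE.
  apply/propext; split=> // C1q; exfalso.
  apply: (cC (Cobweb pq)); first by rewrite ballEmdist; exact: bq.
  have : B (Cobweb pq) by rewrite BC1.
  by rewrite BC2 => -[].
have Hc b : cob_map b = x -> C1 b = H (cvertex (cst x, x)).
  by move=> bx; rewrite -HE; exact: (cob_fiber_constant Hl (cob_valP b)).
apply/seteqP; split=> [b|b bx]; first by rewrite BC1 => -[].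
have ax : cob_map a = x by move: Ba; rewrite BC1 => -[].
by apply/(FB _ bx); rewrite Hc// -(Hc a ax); exact/(FB _ ax).
Qed.

(** Away from vertices the map is locally constant. Near a vertex [(s, b)], points either start
    there or lie on incoming edges of small jump, over terms [s n] with [n] large. *)
Lemma cob_map_open (U : set X) : open U -> open (cob_map @^-1` U).
Proof.
move=> oU; rewrite openE => a Ua; apply/nbhs_ballP.
have pa := cob_valP a; have ra := cob_proper pa.
have [Oa|Oa] := ltP 0 (outer first (cob_val a)).
  exists (outer first (cob_val a)) => // b; rewrite ballEmdist /= => ab.
  by rewrite /cob_map -(level_edge_near ab).
have Oa0 : outer first (cob_val a) = 0.
  by apply/eqP; rewrite eq_le Oa outer_ge0.
have aE := proper_outer ra Oa; set v := src (cob_val a).1 in aE.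
have [vv _ _] := pa; have /vv[N _ NU] : nbhs v.2 U by exact: open_nbhs_nbhs.
(* The bound 1/8 is for [outer_cases]; the other one, as the jump is at most [2 * outer], forces [n]
   to be at least [N]. *)
exists (Num.min 8^-1 (2^-1 * N.+1%:R^-1)).
  by rewrite /= lt_min !invr_gt0 ltr0n/= mulr_gt0 ?invr_gt0.
move=> b; rewrite ballEmdist /= cobweb_mdist lt_min => /andP[b8 bN].
have pb := cob_valP b; have [b1 b2 tb] := pb.
have Ob : outer first (cob_val b) <= level first cdist (cob_val a) (cob_val b).
  have := outer_level_lip first cdist (cob_val b) (cob_val a).
  by rewrite Oa0 add0r (level_sym cdist_tail).
have nb : node first (cob_val b) = v.
  apply: (level_vertex_near (d := cdist) first_sone).
  by rewrite -aE; apply: lt_trans b8 _; lra.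
have b01 := thread_first tb.
have [] := outer_cases b01 (le_lt_trans Ob b8).
  by move=> [b12 _]; move: nb; rewrite /node b12 /cob_map /= => ->.
move=> [b12 _ bj]; move: nb b2 bj; rewrite /node leNgt b12 /= /cob_tgt
  /cob_jump.
rewrite /cob_map; case: (cob_val b).1.2 => [[v' n] -> [_ <-] nj|-> _ _//].
apply: NU => /=; rewrite leqNgt; apply/negP => nN.
have : N.+1%:R^-1 <= n.+1%:R^-1 :> R.
  by rewrite lef_pV2 ?posrE// ler_nat ltnW.
by move: bN nj; move: (N.+1%:R^-1) (n.+1%:R^-1) => s t; lra.
Qed.

(** If [U] is not open, some [s] outside [U] converges to [x] in [U]. The edges from the constant
    sequences at [s n] to [(s, x)] end arbitrarily close to this vertex but lie over [s n]. *)
Lemma cob_map_quotient : sequential_space X -> quotient_map cob_map.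
Proof.
move=> seqX; split; first exact: cob_map_surj.
move=> U; split; first exact: cob_map_open.
move=> oU; rewrite -[U]setCK openC; apply: contrapT => /seqX[s [x [sU Ux sx]]].
have {}Ux : U x by exact: contrapT.
have := oU; rewrite openE => /(_ (cob_vertex sx) Ux)/nbhs_ballP[c /= c0 cU].
have m0 : 0 < Num.min c 4^-1 by rewrite lt_min; lra.
have [n] := natSinv_lt m0; rewrite lt_min => /andP[nc n4].
pose e : edge G := ((cst (s n), s n), Some ((s, x), n)).
have pe : cob_point (e, sone).
  by split=> //=; [exact: cvg_cst|exact: thread_sone].
apply: (sU n); apply: (cU (Cobweb pe)); rewrite ballEmdist /= cobweb_mdist.
exact: le_lt_trans (cob_jump_end _ _ n4) nc.
Qed.

End cobweb_theory.

(** Connected fibers make a clopen set saturated, so its image is clopen in [X]. *)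
Lemma monotone_quotient_connected (E X : topologicalType) (f : E -> X) :
  monotone_map f -> quotient_map f -> connected [set: X] -> connected [set: E].
Proof.
move=> [fsurj fconn] [_ fquot] Xconn B [a Ba] [C1 oC1 BC1] [C2 cC2 BC2].
rewrite setTI in BC1; rewrite setTI in BC2.
have oB : open B by rewrite BC1.
have cB : closed B by rewrite BC2.
have sat y z : B y -> f z = f y -> B z.
  move=> By zy; have : B `&` f @^-1` [set f y] = f @^-1` [set f y].
    apply: fconn; first by exists y.
    - by exists B => //; rewrite setIC.
    - by exists B => //; rewrite setIC.
  by move=> /seteqP[_ /(_ z zy)[]].
have pre : f @^-1` (f @` B) = B.
  by apply/seteqP; split=> z; [move=> [y By /esym]; exact: sat|exists z].
have imT : f @` B = [set: X].
  apply: Xconn; first by exists (f a), a.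
    by exists (f @` B); [apply/fquot; rewrite pre|rewrite setTI].
  exists (f @` B); last by rewrite setTI.
  rewrite -openC; apply/fquot; rewrite -preimage_setC pre openC//.
by rewrite -pre imT.
Qed.

Theorem theorem1p1 (R : realType) (X : topologicalType)
    (hX : sequential_space X) :
  (exists (E : metricType R) (xi : E -> X),
      [/\ complete_space E, economical E, monotone_map xi & quotient_map xi])
  /\ (connected [set: X] ->
      exists (E : metricType R) (xi : E -> X),
        [/\ complete_space E, economical E, monotone_map xi, quotient_map xi
          & connected [set: E]]).
Proof.
have cE := @cobweb_complete R X; have eE := @cobweb_economical R X.
have mE := cob_map_monotone R X; have qE := cob_map_quotient R hX.
split=> [|Xc]; exists (cobweb R X), (@cob_map R X); split=> //.
exact: monotone_quotient_connected mE qE Xc.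
Qed.
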